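(* For each $1\le k\le N$, the fully discrete weak Galerkin scheme admits at least one solution $(\mathbf u_h^k,p_h^k)\in\mathbf V_h^0\times Q_h^0$.
   Context: **Data.** $\Omega\subset\mathbb R^n$ ($n=2,3$) is a polygonal/polyhedral domain, $T>0$, $\nu>0$, $\alpha>0$, and $r$ is a real number with $3\le r<\infty$ if $n=2$ and $3\le r\le 6$ if $n=3$; $\mathbf f(\mathbf x,t)$ is a given forcing term, $\mathbf u_0$ a given initial datum with $\nabla\cdot\mathbf u_0=0$, $\mathbf u_0|_{\partial\Omega}=\mathbf 0$. $(\mathbf u\otimes\mathbf v)_{ij}=u_iv_j$; $(\cdot,\cdot)$ is the $L^2(\Omega)$ inner product; $P_j(\Lambda)$ is the set of polynomials of degree at most $j$ on $\Lambda$. **Mesh.** $\mathcal T_h$ is a shape regular partition of $\Omega$ into closed simplexes, $\mathcal E_h$ the set of its edges/faces, $h_K$ the diameter of $K$, $\mathbf n$ (or $\mathbf n_K$) the outward unit normal on $\partial K$; $\langle\cdot,\cdot\rangle_{\partial\mathcal T_h}=\sum_K\langle\cdot,\cdot\rangle_{\partial K}$. **Weak operators.** For $\gamma\ge0$: for $v=\{v_i,v_b\}$ the discrete weak gradient $\nabla_{w,\gamma}v|_K\in[P_\gamma(K)]^n$ is defined by $(\nabla_{w,\gamma}v,\boldsymbol\varsigma)_K=-(v_i,\nabla\cdot\boldsymbol\varsigma)_K+\langle v_b,\boldsymbol\varsigma\cdot\mathbf n_K\rangle_{\partial K}$ for all $\boldsymbol\varsigma\in[P_\gamma(K)]^n$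 (componentwise for vector functions). For $\mathbf w=\{\mathbf w_i,\mathbf w_b\}$ the discrete weak divergence $\nabla_{w,\gamma}\cdot\mathbf w|_K\in P_\gamma(K)$ is defined by $(\nabla_{w,\gamma}\cdot\mathbf w,\varsigma)_K=-(\mathbf w_i,\nabla\varsigma)_K+\langle\mathbf w_b\cdot\mathbf n,\varsigma\rangle_{\partial K}$ for all $\varsigma\in P_\gamma(K)$ (row-wise for tensors). **Spaces.** Fix integers $m\ge1$ and $l\in\{m-1,m\}$. $\mathbf V_h^0$ is the set of $\mathbf v_h=\{\mathbf v_{hi},\mathbf v_{hb}\}$ with $\mathbf v_{hi}|_K\in[P_m(K)]^n$ for all $K\in\mathcal T_h$, $\mathbf v_{hb}|_e\in[P_m(e)]^n$ for all $e\in\mathcal E_h$, $\mathbf v_{hb}|_{\partial\Omega}=\mathbf 0$. $Q_h^0$ is the set of $q_h=\{q_{hi},q_{hb}\}$ with $q_{hi}|_K\in P_{m-1}(K)$, $q_{hb}|_e\in P_m(e)$, $\int_\Omega q_{hi}=0$. **Forms.** With $\eta|_{\partial K}=h_K^{-1}$: $a_h(\mathbf u_h,\mathbf v_h)=\nu(\nabla_{w,l}\mathbf u_h,\nabla_{w,l}\mathbf v_h)+\nu\langle\eta(\mathbf u_{hi}-\mathbf u_{hb}),\mathbf v_{hi}-\mathbf v_{hb}\rangle_{\partial\mathcal T_h}$; $b_h(\mathbf v_h,q_h)=(\nabla_{w,m}q_h,\mathbf v_{hi})$; $c_h(\boldsymbol\kappa_h;\mathbf u_h,\mathbf v_h)=\alpha(|\boldsymbol\kappa_{hi}|^{r-2}\mathbf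 u_{hi},\mathbf v_{hi})$; $d_h(\boldsymbol\kappa_h;\mathbf u_h,\mathbf v_h)=\frac12(\nabla_{w,m}\cdot\{\mathbf u_{hi}\otimes\boldsymbol\kappa_{hi},\mathbf u_{hb}\otimes\boldsymbol\kappa_{hb}\},\mathbf v_{hi})-\frac12(\nabla_{w,m}\cdot\{\mathbf v_{hi}\otimes\boldsymbol\kappa_{hi},\mathbf v_{hb}\otimes\boldsymbol\kappa_{hb}\},\mathbf u_{hi})$. **Fully discrete scheme.** $N$ is a positive integer, $\Delta t=T/N$, $t_k=k\Delta t$, $\mathbf f^k=\mathbf f(t_k)$, $D_t\mathbf u_{hi}^k=(\mathbf u_{hi}^k-\mathbf u_{hi}^{k-1})/\Delta t$. For each $1\le k\le N$ find $(\mathbf u_h^k,p_h^k)\in\mathbf V_h^0\times Q_h^0$ such that for all $(\mathbf v_h,q_h)\in\mathbf V_h^0\times Q_h^0$ $$(D_t\mathbf u_{hi}^k,\mathbf v_{hi})+a_h(\mathbf u_h^k,\mathbf v_h)+b_h(\mathbf v_h,p_h^k)+c_h(\mathbf u_h^k;\mathbf u_h^k,\mathbf v_h)+d_h(\mathbf u_h^k;\mathbf u_h^k,\mathbf v_h)=(\mathbf f^k,\mathbf v_{hi}),\qquad b_h(\mathbf u_h^k,q_h)=0,$$ with initial value $\mathbf u_h^0=\{\mathbf P_m^{RT}\mathbf u_0,\boldsymbol\Pi_m^B\mathbf u_0\}$, where $\boldsymbol\Pi_m^B$ is the facewise $L^2$-projection onto $[P_m(e)]^n$ and $\mathbf P_m^{RT}$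 is the local Raviart–Thomas projection: on each $K$, $\mathbf P_m^{RT}\boldsymbol\omega\in[P_m(K)]^n+\mathbf xP_m(K)$ satisfies $\langle\mathbf P_m^{RT}\boldsymbol\omega\cdot\mathbf n_e,\sigma\rangle_e=\langle\boldsymbol\omega\cdot\mathbf n_e,\sigma\rangle_e$ for all $\sigma\in P_m(e)$, $e\subset\partial K$, and $(\mathbf P_m^{RT}\boldsymbol\omega,\boldsymbol\sigma)_K=(\boldsymbol\omega,\boldsymbol\sigma)_K$ for all $\boldsymbol\sigma\in[P_{m-1}(K)]^n$. *)

(* Defs.v *)
From HB Require Import structures.
From mathcomp Require Import all_boot all_order all_algebra.
From mathcomp Require Import -(notations) mpoly.
From mathcomp Require Import all_classical all_reals all_analysis.

Set Implicit Arguments.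
Unset Strict Implicit.
Unset Printing Implicit Defensive.

Import Order.TTheory GRing.Theory Num.Theory numFieldNormedType.Exports.

Local Open Scope classical_set_scope.
Local Open Scope ring_scope.

(* Lebesgue measure on R^d, carried by d-tuples: lebesgue_tuple d.+1 is the
   image of (lebesgue_measure \x lebesgue_tuple d) under (x, t) |-> x :: t. *)
Section LebesgueTuple.
Context {R : realType}.
Local Notation RT := (measurableTypeR R).

Definition tcons d (x : RT * d.-tuple RT) : d.+1.-tuple RT :=
  [the d.+1.-tuple RT of x.1 :: x.2].

Lemma measurable_tcons d : measurable_fun [set: RT * d.-tuple RT] (@tcons d).
Proof. exact: measurable_cons. Qed.

Section Step.
Context d (m : {sigma_finite_measure set (d.-tuple RT) -> \bar R}).

Definition lebesgue_cons : set (d.+1.-tuple RT) -> \bar R :=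
  pushforward (lebesgue_measure \x m)%E (@tcons d).

Let lebesgue_cons0 : lebesgue_cons set0 = 0%E.
Proof. by rewrite /lebesgue_cons /pushforward preimage_set0 measure0. Qed.

Let lebesgue_cons_ge0 A : (0 <= lebesgue_cons A)%E.
Proof. by rewrite /lebesgue_cons /pushforward; exact: measure_ge0. Qed.

Let lebesgue_cons_sigma_additive : semi_sigma_additive lebesgue_cons.
Proof.
move=> F mF tF mUF; rewrite /lebesgue_cons /pushforward preimage_bigcup.
apply: measure_semi_sigma_additive.
- by move=> i; rewrite -[X in measurable X]setTI; exact: measurable_tcons.
- apply/trivIsetP => /= i j _ _ ij; rewrite -preimage_setI.
  by move/trivIsetP : tF => /(_ _ _ _ _ ij) ->//; rewrite preimage_set0.
- by rewrite -preimage_bigcup -[X in measurable X]setTI; exact: measurable_tcons.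
Qed.

HB.instance Definition _ := isMeasure.Build _ _ _ lebesgue_cons
  lebesgue_cons0 lebesgue_cons_ge0 lebesgue_cons_sigma_additive.

Let lebesgue_cons_sigma_finite : sigma_finite setT lebesgue_cons.
Proof.
have /sigma_finiteP[F [TF ndF Foo]] := sigma_finiteT (@lebesgue_measure R).
have /sigma_finiteP[G [TG ndG Goo]] := sigma_finiteT m.
pose split (t : d.+1.-tuple RT) : RT * d.-tuple RT :=
  (tnth t ord0, [tuple of behead t]).
have msplit : measurable_fun setT split.
  apply: measurable_fun_pair; first exact: measurable_tnth.
  exact: measurable_behead.
have splitK x : split (tcons x) = x.
  by case: x => x t; congr pair => //; apply/val_inj.
exists (fun i => split @^-1` (F i `*` G i)).
  apply/esym; rewrite -subTset => t _.
  have [i _ Fi] : (\bigcup_i F i) (split t).1 by rewrite -TF.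
  have [j _ Gj] : (\bigcup_i G i) (split t).2 by rewrite -TG.
  exists (maxn i j) => //; split.
    by move: Fi; exact/subsetPset/ndF/leq_maxl.
  by move: Gj; exact/subsetPset/ndG/leq_maxr.
move=> i; have [? ?] := Foo i; have [? ?] := Goo i; split.
  by rewrite -[X in measurable X]setTI; apply: msplit => //; exact: measurableX.
rewrite /lebesgue_cons /pushforward.
rewrite (_ : _ @^-1` _ = F i `*` G i); last first.
  by rewrite -comp_preimage (_ : split \o _ = id)//; apply/funext => x; exact: splitK.
by rewrite product_measure1E// lte_mul_pinfty// ge0_fin_numE.
Qed.

HB.instance Definition _ := Measure_isSigmaFinite.Build _ _ _
  lebesgue_cons lebesgue_cons_sigma_finite.

End Step.

Fixpoint lebesgue_tuple d : {sigma_finite_measure set (d.-tuple RT) -> \bar R} :=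
  match d with
  | 0 => \d_([tuple] : 0.-tuple RT)
  | d'.+1 => lebesgue_cons (lebesgue_tuple d')
  end.

End LebesgueTuple.

Section EuclideanSpace.
Context {R : realType}.
Local Notation RT := (measurableTypeR R).

Definition vec_of_tuple d (t : d.-tuple RT) : 'rV[R]_d := \row_i tnth t i.

Definition int_on n (D : set 'rV[R]_n) (g : 'rV[R]_n -> R) : R :=
  \int[lebesgue_tuple n]_(t in @vec_of_tuple n @^-1` D) g (vec_of_tuple t).

Definition L2_on n (D : set 'rV[R]_n) (g : 'rV[R]_n -> R) : Prop :=
  measurable_fun (@vec_of_tuple n @^-1` D) (g \o @vec_of_tuple n) /\
  (\int[lebesgue_tuple n]_(t in @vec_of_tuple n @^-1` D)
     ((g (vec_of_tuple t)) ^+ 2)%:E < +oo)%E.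

(* The library norm on row vectors is the max norm. *)
Definition dotv n (x y : 'rV[R]_n) : R := \sum_i x 0 i * y 0 i.
Definition enorm n (x : 'rV[R]_n) : R := Num.sqrt (dotv x x).

Definition diam n (A : set 'rV[R]_n) : R :=
  sup [set d | exists x y, [/\ A x, A y & d = enorm (x - y)]].

Definition inball_diam n (A : set 'rV[R]_n) : R :=
  sup [set d | exists x rho, [/\ 0 <= rho,
    [set y | enorm (y - x) <= rho] `<=` A & d = rho *+ 2]].

Definition hull n (I : finType) (P : I -> 'rV[R]_n) (s : {set I}) : set 'rV[R]_n :=
  [set x | exists lam : I -> R,
    [/\ forall j, 0 <= lam j, forall j, j \notin s -> lam j = 0,
        \sum_j lam j = 1 & x = \sum_j lam j *: P j]].

Definition aff_indep n (I : finType) (P : I -> 'rV[R]_n) (s : {set I}) : Prop :=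
  forall lam : I -> R, (forall j, j \notin s -> lam j = 0) ->
    \sum_j lam j = 0 -> \sum_j lam j *: P j = 0 -> forall j, lam j = 0.

Definition bdry n (A : set 'rV[R]_n) : set 'rV[R]_n := closure A `\` A°.

(* A bounded domain whose boundary is a finite union of (n-1)-simplices. *)
Definition polyhedral_domain n (Omega : set 'rV[R]_n) : Prop :=
  [/\ Omega !=set0, open Omega, connected Omega, bounded_set Omega &
      exists (k : nat) (P : 'I_k -> 'rV[R]_n) (F : {set {set 'I_k}}),
        (forall e, e \in F -> #|e| = n /\ aff_indep P e) /\
        bdry Omega = \bigcup_(e in [set` F]) hull P e].

Fixpoint is_Ck n (k : nat) (phi : 'rV[R]_n -> R) : Prop :=
  continuous phi /\
  if k is k'.+1 then
    forall i : 'I_n, (forall x, derivable phi x (delta_mx 0 i)) /\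
      is_Ck k' (fun x => 'D_(delta_mx 0 i) phi x)
  else True.

Definition test_function n (Omega : set 'rV[R]_n) (phi : 'rV[R]_n -> R) : Prop :=
  (forall k, is_Ck k phi) /\
  exists C : set 'rV[R]_n,
    [/\ compact C, C `<=` Omega & forall x, ~ C x -> phi x = 0].

Definition weak_div_free n (Omega : set 'rV[R]_n) (w : 'rV[R]_n -> 'rV[R]_n) : Prop :=
  forall phi, test_function Omega phi ->
    int_on Omega (fun x => \sum_i w x 0 i * 'D_(delta_mx 0 i) phi x) = 0.

End EuclideanSpace.

Section Polynomials.
Context {R : realType} {n : nat}.

Definition deg_le (j : nat) (p : mpoly n R) : Prop := (mpoly.msize p <= j.+1)%N.
Definition vdeg_le (j : nat) (p : 'rV[mpoly n R]_n) : Prop :=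
  forall i, deg_le j (p 0 i).

Definition pev (p : mpoly n R) (x : 'rV[R]_n) : R := meval (fun i => x 0 i) p.
Definition vpev (p : 'rV[mpoly n R]_n) (x : 'rV[R]_n) : 'rV[R]_n :=
  \row_i pev (p 0 i) x.

Definition pgrad (p : mpoly n R) : 'rV[mpoly n R]_n := \row_i mderiv i p.
Definition pdiv (p : 'rV[mpoly n R]_n) : mpoly n R := \sum_i mderiv i (p 0 i).

End Polynomials.

(* A cell is the set of its n+1 nodes, a face a set of n nodes, so that a face
   shared by two cells is a single index. *)
Record mesh (R : realType) (n : nat) := Mesh {
  nnodes : nat;
  node : 'I_nnodes -> 'rV[R]_n;
  cells : {set {set 'I_nnodes}} }.
Arguments node {R n} m.
Arguments cells {R n} m.

Section Mesh.
Context {R : realType} {n : nat} (M : mesh R n).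
Local Notation RT := (measurableTypeR R).
Local Notation simplex := {set 'I_(nnodes M)}.

Definition geom (s : simplex) : set 'rV[R]_n := hull (node M) s.

Definition facet (K e : simplex) : bool := (e \subset K) && (#|e| == n).
Definition mesh_face (e : simplex) : bool := [exists K in cells M, facet K e].

Definition is_partition (Omega : set 'rV[R]_n) : Prop :=
  [/\ forall K, K \in cells M -> #|K| = n.+1 /\ aff_indep (node M) K,
      forall K L, K \in cells M -> L \in cells M ->
        geom K `&` geom L = geom (K :&: L),
      closure Omega = \bigcup_(K in [set` cells M]) geom K &
      forall K, K \in cells M -> (geom K)° `<=` Omega].

Definition hK (K : simplex) : R := diam (geom K).

Definition shape_regular (sigma : R) : Prop :=
  forall K, K \in cells M -> hK K <= sigma * inball_diam (geom K).

Definition int_cell (K : simplex) (g : 'rV[R]_n -> R) : R := int_on (geom K) g.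

(* Surface integral over a face, through its affine parametrization by the
   reference simplex of R^(n-1); the area element is the square root of the
   Gram determinant of the edge vectors. *)
Definition ref_simplex d : set (d.-tuple RT) :=
  [set t | (forall i, 0 <= tnth t i :> R) /\ \sum_i (tnth t i : R) <= 1].

Definition vertex (e : simplex) (i : nat) : 'rV[R]_n :=
  nth 0 [seq node M j | j <- enum e] i.

Definition face_edges (e : simplex) : 'M[R]_(n.-1, n) :=
  \matrix_(i, j) (vertex e i.+1 - vertex e 0) 0 j.

Definition face_param (e : simplex) (t : n.-1.-tuple RT) : 'rV[R]_n :=
  vertex e 0 + vec_of_tuple t *m face_edges e.

Definition int_face (e : simplex) (g : 'rV[R]_n -> R) : R :=
  Num.sqrt (\det (face_edges e *m (face_edges e)^T)) *
  \int[lebesgue_tuple n.-1]_(t in @ref_simplex n.-1) g (face_param e t).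

Definition L2_face (e : simplex) (g : 'rV[R]_n -> R) : Prop :=
  measurable_fun (@ref_simplex n.-1) (g \o face_param e) /\
  (\int[lebesgue_tuple n.-1]_(t in @ref_simplex n.-1)
     ((g (face_param e t)) ^+ 2)%:E < +oo)%E.

Definition is_outward_normal (K e : simplex) (nu : 'rV[R]_n) : Prop :=
  [/\ enorm nu = 1,
      forall i j, i \in e -> j \in e -> dotv nu (node M j - node M i) = 0 &
      forall i j, i \in e -> j \in K -> j \notin e ->
        dotv nu (node M j - node M i) < 0].

(* In normal, weak_grad and weak_div, xget selects an element that exists and is
   unique when K is a nondegenerate simplex (for the weak operators, by Riesz
   representation in the polynomial space with the L2(K) inner product). *)
Definition normal (K e : simplex) : 'rV[R]_n := xget 0 (is_outward_normal K e).

Definition is_weak_grad (gam : nat) (K : simplex) (vi : 'rV[R]_n -> R)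
    (vb : simplex -> 'rV[R]_n -> R) (G : 'rV[mpoly n R]_n) : Prop :=
  vdeg_le gam G /\
  forall s : 'rV[mpoly n R]_n, vdeg_le gam s ->
    int_cell K (fun x => dotv (vpev G x) (vpev s x)) =
    - int_cell K (fun x => vi x * pev (pdiv s) x) +
    \sum_(e | facet K e)
      int_face e (fun x => vb e x * dotv (vpev s x) (normal K e)).

Definition weak_grad gam K vi vb : 'rV[mpoly n R]_n :=
  xget 0 (is_weak_grad gam K vi vb).

Definition is_weak_div (gam : nat) (K : simplex) (wi : 'rV[R]_n -> 'rV[R]_n)
    (wb : simplex -> 'rV[R]_n -> 'rV[R]_n) (D : mpoly n R) : Prop :=
  deg_le gam D /\
  forall s : mpoly n R, deg_le gam s ->
    int_cell K (fun x => pev D x * pev s x) =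
    - int_cell K (fun x => dotv (wi x) (vpev (pgrad s) x)) +
    \sum_(e | facet K e)
      int_face e (fun x => dotv (wb e x) (normal K e) * pev s x).

Definition weak_div gam K wi wb : mpoly n R := xget 0 (is_weak_div gam K wi wb).

(* Only the values at cells (first component) and at mesh faces (second
   component) matter. A polynomial on a face e is represented by a polynomial
   on R^n, of which only the restriction to e is meaningful. *)
Record velocity := Velocity {
  vin : simplex -> 'rV[mpoly n R]_n;
  vbd : simplex -> 'rV[mpoly n R]_n }.

Record pressure := Pressure {
  pin : simplex -> mpoly n R;
  pbd : simplex -> mpoly n R }.

Definition in_V0 (Omega : set 'rV[R]_n) (m : nat) (v : velocity) : Prop :=
  [/\ forall K, K \in cells M -> vdeg_le m (vin v K),
      forall e, mesh_face e -> vdeg_le m (vbd v e) &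
      forall e, mesh_face e -> geom e `<=` bdry Omega ->
        forall x, geom e x -> vpev (vbd v e) x = 0].

Definition in_Q0 (m : nat) (q : pressure) : Prop :=
  [/\ forall K, K \in cells M -> deg_le m.-1 (pin q K),
      forall e, mesh_face e -> deg_le m (pbd q e) &
      \sum_(K in cells M) int_cell K (pev (pin q K)) = 0].

Definition l2_inner (u v : simplex -> 'rV[R]_n -> 'rV[R]_n) : R :=
  \sum_(K in cells M) int_cell K (fun x => dotv (u K x) (v K x)).

Definition vgrad (gam : nat) (v : velocity) (K : simplex) (i : 'I_n)
    : 'rV[mpoly n R]_n :=
  weak_grad gam K (pev (vin v K 0 i)) (fun e => pev (vbd v e 0 i)).

Definition form_a (nu : R) (l : nat) (u v : velocity) : R :=
  nu * (\sum_(K in cells M) \sum_i int_cell K (fun x =>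
          dotv (vpev (vgrad l u K i) x) (vpev (vgrad l v K i) x))) +
  nu * (\sum_(K in cells M) \sum_(e | facet K e) int_face e (fun x =>
          (hK K)^-1 * dotv (vpev (vin u K) x - vpev (vbd u e) x)
                           (vpev (vin v K) x - vpev (vbd v e) x))).

Definition form_b (m : nat) (v : velocity) (q : pressure) : R :=
  l2_inner (fun K => vpev (weak_grad m K (pev (pin q K)) (fun e => pev (pbd q e))))
           (fun K => vpev (vin v K)).

Definition form_c (alpha r : R) (k u v : velocity) : R :=
  alpha * l2_inner
    (fun K x => enorm (vpev (vin k K) x) `^ (r - 2) *: vpev (vin u K) x)
    (fun K => vpev (vin v K)).

(* Row i of the tensor u \otimes k is u_i k. *)
Definition tensor_div (m : nat) (u k : velocity) (K : simplex) (x : 'rV[R]_n)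
    : 'rV[R]_n :=
  \row_i pev (weak_div m K
    (fun y => pev (vin u K 0 i) y *: vpev (vin k K) y)
    (fun e y => pev (vbd u e 0 i) y *: vpev (vbd k e) y)) x.

Definition form_d (m : nat) (k u v : velocity) : R :=
  2^-1 * l2_inner (tensor_div m u k) (fun K => vpev (vin v K)) -
  2^-1 * l2_inner (tensor_div m v k) (fun K => vpev (vin u K)).

Definition is_RT_projection (m : nat) (K : simplex) (w : 'rV[R]_n -> 'rV[R]_n)
    (g : 'rV[mpoly n R]_n) : Prop :=
  [/\ exists (a : 'rV[mpoly n R]_n) (b : mpoly n R),
        [/\ vdeg_le m a, deg_le m b &
            g = a + \row_i (mpolyX R (mnm1 i) * b)],
      forall e (s : mpoly n R), facet K e -> deg_le m s ->
        int_face e (fun x => dotv (vpev g x) (normal K e) * pev s x) =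
        int_face e (fun x => dotv (w x) (normal K e) * pev s x) &
      forall s : 'rV[mpoly n R]_n, vdeg_le m.-1 s ->
        int_cell K (fun x => dotv (vpev g x) (vpev s x)) =
        int_cell K (fun x => dotv (w x) (vpev s x))].

Definition is_face_projection (m : nat) (e : simplex) (w : 'rV[R]_n -> 'rV[R]_n)
    (g : 'rV[mpoly n R]_n) : Prop :=
  vdeg_le m g /\
  forall s : 'rV[mpoly n R]_n, vdeg_le m s ->
    int_face e (fun x => dotv (vpev g x) (vpev s x)) =
    int_face e (fun x => dotv (w x) (vpev s x)).

Definition initial_value (m : nat) (u0 : 'rV[R]_n -> 'rV[R]_n) (u : velocity) : Prop :=
  (forall K, K \in cells M -> is_RT_projection m K u0 (vin u K)) /\
  (forall e, mesh_face e -> is_face_projection m e u0 (vbd u e)).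

(* The divergence condition is distributional; the values of u0 on the mesh
   faces and on the boundary of Omega stand for its traces. *)
Definition initial_datum (Omega : set 'rV[R]_n) (u0 : 'rV[R]_n -> 'rV[R]_n) : Prop :=
  [/\ forall i, L2_on (closure Omega) (fun x => u0 x 0 i),
      forall e i, mesh_face e -> L2_face e (fun x => u0 x 0 i),
      weak_div_free Omega u0 &
      forall x, bdry Omega x -> u0 x = 0].

Definition solves_step (Omega : set 'rV[R]_n) (m l : nat) (nu alpha r dt : R)
    (fk : 'rV[R]_n -> 'rV[R]_n) (uprev u : velocity) (p : pressure) : Prop :=
  [/\ in_V0 Omega m u, in_Q0 m p &
      forall v q, in_V0 Omega m v -> in_Q0 m q ->
        l2_inner (fun K x => dt^-1 *: (vpev (vin u K) x - vpev (vin uprev K) x))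
                 (fun K => vpev (vin v K)) +
        form_a nu l u v + form_b m v p + form_c alpha r u u v + form_d m u u v =
        l2_inner (fun=> fk) (fun K => vpev (vin v K)) /\
        form_b m u q = 0].

End Mesh.

(* Main.v *)
Require Import Defs.
From mathcomp Require Import all_boot all_order all_algebra.
From mathcomp Require Import -(notations) mpoly.
From mathcomp Require Import all_classical all_reals all_analysis.
From mathcomp Require Import measurable_realfun.
From mathcomp Require Import ring lra.

(** Each time step is a finite-dimensional nonlinear system. The velocity is
    found first, in the space X of discretely divergence-free elements of
    V_h^0, and the pressure is then the multiplier of that constraint.

    On X the system reads s(u, v) + T(u, v) = g(v) for all v in X. Here
    s = (., .)/dt + a_h is symmetric and positive semidefinite, T is the sum of
    the reaction and convection terms and g collects the load and the previous
    step. The convection form vanishes on the diagonal, so T(u, u) is the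
    reaction energy, which is nonnegative. Take a family that is orthonormal
    for s and spans X modulo the kernel of s, and let y be the coordinates of u
    in it: the residual tested with u is at least y.y - gam.y for a fixed vector
    gam, hence positive for large y, and a continuous coercive vector field has
    a zero (coercive_zero). The kernel of s consists of the functions that
    vanish in the cells and, almost everywhere, on the faces; all terms of the
    equation vanish on them, so testing with the orthonormal family is enough
    (galerkin). The form s can be degenerate because a polynomial on a face is
    represented by a polynomial on the whole space.

    The zero of a coercive field comes from the Poincare-Miranda theorem, and
    that one from a labelling lemma on a cubical grid (kuhn): if the i-th 0-1
    label is 0 on the lower and 1 on the upper face in direction i, some cube of
    the grid sees both values of every label. The labels are 0-cochains over
    F_2; the cup product of their coboundaries is exact, so that its sum over
    the grid telescopes to a sum over one face, and induction on the dimension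
    shows that the total is 1.

    For the pressure, the residual is a linear functional on V_h^0 which
    vanishes wherever all b_h(., q) do; in finite dimension it is then one of
    these functionals (multiplier).

    The analytic part has to show that the forms are multilinear and continuous
    in the coefficients. The weak operators are defined by choosing a solution
    of their defining identity. Such a solution exists by Riesz representation
    (riesz), because the L2 product of a nondegenerate cell is definite on
    polynomials (cell_definite). The defining identities then express every
    form through integrals in which u, v and q appear linearly; this is how
    bilinearity of a_h and b_h and trilinearity of d_h are obtained. The
    reaction term is an integral with a parameter, continuous by compactness
    (int_cell_continuous). *)

Set Implicit Arguments.
Unset Strict Implicit.
Unset Printing Implicit Defensive.

Import Order.TTheory GRing.Theory Num.Theory numFieldNormedType.Exports.

Local Open Scope ring_scope.

(** * A cubical labelling lemma *)

Lemma F2_addxx (a : 'F_2) : a + a = 0.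
Proof. by rewrite (addrr_pchar2 (pchar_Fp _)). Qed.

Lemma F2_neq0 (a : 'F_2) : a != 0 -> a = 1.
Proof. by case: a => -[|[|//]] i // _; apply/val_inj. Qed.

(** Over F_2 the terms (i, j) and (j, i) cancel. *)
Lemma sum_sym_F2 (I : finType) (A : {set I}) (g : I -> I -> 'F_2) :
  (forall i j, g i j = g j i) -> \sum_(i in A) \sum_(j in A :\ i) g i j = 0.
Proof.
move=> gC.
pose lt (i j : I) := (enum_rank i < enum_rank j)%N.
have split i : \sum_(j in A :\ i) g i j =
    \sum_(j in A | lt i j) g i j + \sum_(j in A | lt j i) g i j.
  rewrite (bigID (lt i)) /=; congr (_ + _); apply: eq_bigl => j;
    rewrite !inE -?leqNgt /lt; case: (j \in A); rewrite ?andbF //= ?andbT.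
    by rewrite -(inj_eq enum_rank_inj) -val_eqE /=; case: ltngtP.
  by rewrite -(inj_eq enum_rank_inj) -val_eqE /=; case: ltngtP.
rewrite (eq_bigr _ (fun i _ => split i)) big_split /=.
rewrite [X in _ + X](exchange_big_dep (mem A)) /=; last by move=> i j _ /andP[].
rewrite -big_split /= big1 // => i iA.
rewrite [X in _ + X](_ : _ = \sum_(j in A | lt i j) g i j) ?F2_addxx //.
by apply: eq_big => [j|j _]; rewrite ?iA.
Qed.

Section Kuhn.
Variables (n : nat) (x : nat -> ('I_n -> nat) -> 'F_2).
Implicit Types (A B : {set 'I_n}) (q : 'I_n -> nat).

Definition shift A q : 'I_n -> nat := fun i => (q i + (i \in A))%N.

(** Cochains on the cubical grid are functions of a set A of directions and of a
    base point q, standing for the cube q + [0,1]^A; this is the coboundary. *)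
Definition cobd (h : {set 'I_n} -> ('I_n -> nat) -> 'F_2) A q : 'F_2 :=
  \sum_(j in A) (h (A :\ j) (shift [set j] q) - h (A :\ j) q).

(** Cup product (Serre's formula) of the coboundaries of the first k labels,
    evaluated on the cube q + [0,1]^A. *)
Fixpoint cup k A q : 'F_2 :=
  if k is k'.+1 then
    \sum_(j in A) cup k' (A :\ j) q * (x k' (shift A q) - x k' (shift (A :\ j) q))
  else 1.

(** The cochain whose coboundary is the next cup product. *)
Definition cupx k A q : 'F_2 := cup k A q * x k (shift A q).

Lemma shiftC i j q : shift [set i] (shift [set j] q) = shift [set j] (shift [set i] q).
Proof. by apply/funext => l; rewrite /shift addnAC. Qed.

Lemma shiftD1 A j q : j \in A -> shift (A :\ j) (shift [set j] q) = shift A q.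
Proof.
move=> jA; apply/funext => l; rewrite /shift !inE.
by case: eqVneq => [->|_] //=; rewrite ?jA !addn0 // addn1.
Qed.

Lemma cobdK h B q : cobd (cobd h) B q = 0.
Proof.
pose g i j := h (B :\ i :\ j) (shift [set j] (shift [set i] q))
   - h (B :\ i :\ j) (shift [set i] q) - h (B :\ i :\ j) (shift [set j] q)
   + h (B :\ i :\ j) q.
rewrite -[RHS](@sum_sym_F2 _ B g) => [|i j]; last first.
  have E : B :\ i :\ j = B :\ j :\ i by rewrite !finset.setDDl finset.setUC.
  by rewrite /g E shiftC; ring.
apply: eq_bigr => j _; rewrite -sumrB; apply: eq_bigr => i _.
by rewrite /g; ring.
Qed.

(** Leibniz rule: the coboundary of the product of the closed cochain cup k and
    of the label x k is the product of cup k and of the coboundary of x k. *)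
Lemma cup_exact k : (forall B q, cobd (cup k) B q = 0) ->
  forall A q, cup k.+1 A q = cobd (cupx k) A q.
Proof.
move=> ck A q; apply/eqP; rewrite eq_sym -subr_eq0 /= -sumrB.
rewrite (eq_bigr (fun j => (cup k (A :\ j) (shift [set j] q) - cup k (A :\ j) q)
   * x k (shift A q))) => [|j jA]; last by rewrite /cupx shiftD1 //; ring.
by rewrite -mulr_suml -/(cobd (cup k) A q) ck mul0r.
Qed.

Lemma cup_closed k B q : cobd (cup k) B q = 0.
Proof.
elim: k B q => [|k IHk] B q.
  by rewrite /cobd big1 // => j _; rewrite subrr.
rewrite -[RHS](cobdK (cupx k) B q) /cobd; apply: eq_bigr => j _.
by rewrite !cup_exact.
Qed.

(** A label which is constant on the hyperplane of q has zero coboundary there,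
    and the product contains that coboundary as a factor. *)
Lemma cup_const k A q (j : 'I_n) a : j \notin A -> (j < k)%N ->
  (forall q', q' j = q j -> x j q' = a) -> cup k A q = 0.
Proof.
move=> jA jk xa; elim: k A jA jk => // k IHk A jA; rewrite ltnS leq_eqVlt => jk.
rewrite /= big1 // => i iA; case/orP: jk => [/eqP <-|jk].
  rewrite !xa ?subrr ?mulr0 // /shift ?inE (negPf jA) ?andbF addn0 //.
by rewrite IHk ?mul0r // !inE (negPf jA) andbF.
Qed.

Lemma cup_neq0 k A q (j : nat) : cup k A q != 0 -> (j < k)%N ->
  exists B C, x j (shift B q) != x j (shift C q).
Proof.
elim: k A => // k IHk A; rewrite ltnS leq_eqVlt => cn jk.
have [i [cAi xAi]] : exists i, cup k (A :\ i) q != 0 /\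
    x k (shift A q) - x k (shift (A :\ i) q) != 0.
  apply/not_existsP => H; move/negP: cn; apply; rewrite /= big1 // => i _.
  apply/eqP; rewrite mulf_eq0; apply/negPn/negP; rewrite negb_or => /andP[h1 h2].
  by apply: (H i).
case/orP: jk => [/eqP ->|jk]; last exact: IHk cAi jk.
by exists A, (A :\ i); rewrite -subr_eq0.
Qed.

Variable p : nat.
Implicit Type f : {ffun 'I_n -> 'I_p.+1}.

Definition gridpt f : 'I_n -> nat := fun i => f i.

Definition setcoord f j (c : 'I_p.+1) : {ffun 'I_n -> 'I_p.+1} :=
  [ffun i => if i == j then c else f i].

(** Shifting by one unit in direction j is a bijection between the points off
    the upper face and the points off the lower face. *)
Lemma sum_telescope (j : 'I_n) (P : pred {ffun 'I_n -> 'I_p.+1})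
    (h : ('I_n -> nat) -> 'F_2) :
  (forall f c, P (setcoord f j c) = P f) ->
  \sum_(f | P f && (f j < p)%N) (h (shift [set j] (gridpt f)) - h (gridpt f)) =
  \sum_(f | P f && (f j == p :> nat)) h (gridpt f) -
  \sum_(f | P f && (f j == 0 :> nat)) h (gridpt f).
Proof.
move=> Pj; rewrite sumrB.
pose up f := setcoord f j (inord (f j).+1).
pose dn f := setcoord f j (inord (f j).-1).
have upE f : (f j < p)%N -> gridpt (up f) = shift [set j] (gridpt f).
  move=> fp; apply/funext => i; rewrite /gridpt /shift ffunE inE.
  by case: eqVneq => [->|_]; rewrite ?inordK ?addn1 ?addn0.
have -> : \sum_(f | P f && (f j < p)%N) h (shift [set j] (gridpt f)) =
    \sum_(f | P f && (f j != 0 :> nat)) h (gridpt f).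
  rewrite [RHS](reindex_onto up dn) => [|f /andP[_ f0]].
    have upj f : up f j = (if (f j < p)%N then (f j).+1 else 0%N) :> nat.
      by rewrite ffunE eqxx /inord val_insubd ltnS.
    apply: eq_big => [f|f /andP[_ /upE ->]] //; rewrite Pj upj.
    case: ltnP => fp; rewrite ?andbF //= andbT.
    rewrite (_ : dn (up f) = f) ?eqxx ?andbT //; apply/ffunP => i.
    rewrite /dn upj fp /= !ffunE; case: eqVneq => [->|//].
    by apply/val_inj; rewrite /= inordK.
  apply/ffunP => i; rewrite !ffunE eqxx; case: eqVneq => [->|] //.
  have fj : ((f j).-1 < p.+1)%N by rewrite (leq_ltn_trans (leq_pred _)).
  by apply/val_inj; rewrite /= (inordK fj) prednK ?lt0n // inordK.
have E1 := @bigID _ _ +%R _ (index_enum _) (fun f => f j == 0%N :> nat) P (h \o gridpt).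
have E2 := @bigID _ _ +%R _ (index_enum _) (fun f => f j == p :> nat) P (h \o gridpt).
rewrite E2 /= in E1.
rewrite [X in _ - X](_ : _ = \sum_(f | P f && (f j != p :> nat)) h (gridpt f)).
  by apply/eqP; rewrite subr_eq addrAC eq_sym subr_eq E1 addrC.
by apply: eq_bigl => f; rewrite ltn_neqAle -ltnS ltn_ord andbT.
Qed.

Hypothesis x_low : forall (j : 'I_n) q, q j = 0%N -> x j q = 0.
Hypothesis x_high : forall (j : 'I_n) q, q j = p -> x j q = 1.

(** The base points of the k-dimensional cubes with directions 0, ..., k - 1 in
    the face of the grid on which the other coordinates are maximal. *)
Definition boxpred k f :=
  [forall i : 'I_n, if (i < k)%N then (f i < p)%N else f i == p :> nat].

Definition below k : {set 'I_n} := [set i : 'I_n | (i < k)%N].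

(** By exactness the sum over a (k+1)-dimensional face telescopes to its
    boundary. In direction j < k the label x j is constant on both boundary
    faces and kills the product. In direction k the lower face carries the
    value 0 of x k, and the upper face its value 1, which leaves the
    k-dimensional sum. *)
Lemma sum_cup k : (k <= n)%N -> \sum_(f | boxpred k f) cup k (below k) (gridpt f) = 1.
Proof.
elim: k => [|k IHk] kn.
  rewrite (big_pred1 [ffun => ord_max]) // => f /=; apply/forallP/eqP => [H|-> i].
    by apply/ffunP => i; rewrite ffunE; apply/val_inj/eqP/(H i).
  by rewrite ffunE.
rewrite (eq_bigr _ (fun f _ => cup_exact (cup_closed k) (below k.+1) (gridpt f))).
rewrite /cobd exchange_big /=.
pose K := Ordinal kn.
rewrite (bigD1 K) ?inE //= [X in _ + X]big1 ?addr0 => [|j /andP[jk jK]].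
  pose P f := [forall i : 'I_n, if (i < k)%N then (f i < p)%N else
                 (i == K) || (f i == p :> nat)].
  rewrite (eq_bigl (fun f => P f && (f K < p)%N)) => [|f]; last first.
    apply/forallP/andP => [H|[/forallP H fp] i].
      split; last by have := H K; rewrite ltnSn.
      apply/forallP => i; have := H i; rewrite (ltnS i k) (leq_eqVlt i k).
      by rewrite -val_eqE /=; case: ltngtP.
    have := H i; rewrite (ltnS i k) (leq_eqVlt i k) -val_eqE /=; case: ltngtP => //=.
    by move=> ik _; rewrite (_ : i = K) //; apply: ord_inj.
  rewrite (sum_telescope (fun q => cupx k (below k.+1 :\ K) q)); last first.
    move=> f c; apply: eq_forallb => i; rewrite ffunE.
    case: eqVneq => //= ->; by rewrite ltnn.
  have bK : below k.+1 :\ K = below k.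
    apply/setP => i; rewrite !inE -val_eqE /= (ltnS i k) (leq_eqVlt i k).
    by case: ltngtP.
  have xs q : shift (below k) q K = q K by rewrite /shift inE ltnn addn0.
  rewrite bK [X in _ - X]big1 ?subr0 => [|f /andP[_ /eqP fK]]; last first.
    by rewrite /cupx (@x_low K) ?mulr0 // xs.
  rewrite -[RHS](IHk (ltnW kn)); apply: eq_big => [f|f /andP[_ /eqP fK]]; last first.
    by rewrite /cupx (@x_high K) ?mulr1 // xs.
  apply/andP/forallP => [[/forallP H fp] i|H].
    have := H i; rewrite -val_eqE /=; case: ltngtP => //= ik _.
    by have -> : i = K by apply/val_inj.
  split; last by have := H K; rewrite ltnn.
  by apply/forallP => i; have := H i; case: ifP => // _ ->; rewrite orbT.
have {}jk : (j < k)%N.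
  by move: jk jK; rewrite inE ltnS leq_eqVlt -val_eqE /=; case: ltngtP.
pose P f := [forall i : 'I_n, (i == j) ||
    if (i < k.+1)%N then (f i < p)%N else f i == p :> nat].
rewrite (eq_bigl (fun f => P f && (f j < p)%N)) => [|f]; last first.
  apply/forallP/andP => [H|[/forallP H fp] i].
    split; last by have := H j; rewrite ltnS (ltnW jk).
    by apply/forallP => i; rewrite H orbT.
  have := H i; case: eqVneq => [->|] //= _; by rewrite ltnS (ltnW jk).
rewrite (sum_telescope (fun q => cupx k (below k.+1 :\ j) q)); last first.
  by move=> f c; apply: eq_forallb => i; rewrite ffunE; case: eqVneq.
rewrite !big1 ?subrr // => f /andP[_ /eqP fj]; rewrite /cupx.
  rewrite (@cup_const _ _ _ j 0) ?mul0r ?inE ?eqxx // => q' qj.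
  by apply: x_low; rewrite qj.
rewrite (@cup_const _ _ _ j 1) ?mul0r ?inE ?eqxx // => q' qj.
by apply: x_high; rewrite qj.
Qed.

(** The sum of the top cup product is nonzero, hence so is one of its terms,
    and a nonzero term needs a jump of every label within one cube. *)
Lemma kuhn : exists2 q : 'I_n -> nat, (forall i, q i < p)%N &
  forall i : 'I_n, exists B C, x i (shift B q) = 0 /\ x i (shift C q) = 1.
Proof.
have : \sum_(f | boxpred n f) cup n (below n) (gridpt f) != 0.
  by rewrite sum_cup.
move=> s0; have [f [bf cf]] : exists f, boxpred n f /\
    cup n (below n) (gridpt f) != 0.
  apply/not_existsP => H; move/negP: s0; apply; rewrite big1 // => f bf.
  by apply/eqP/negP => /negP cf; apply: (H f).
exists (gridpt f) => [i|i].
  by move/forallP: bf => /(_ i); rewrite ltn_ord.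
have [B [C]] := cup_neq0 cf (ltn_ord i).
have [B0|/F2_neq0 B1] := eqVneq (x i (shift B (gridpt f))) 0.
  by rewrite B0 eq_sym => /F2_neq0 C1; exists B, C.
have [C0|/F2_neq0 C1] := eqVneq (x i (shift C (gridpt f))) 0.
  by exists C, B.
by rewrite B1 C1.
Qed.

End Kuhn.

Local Open Scope classical_set_scope.
Local Open Scope ring_scope.

(** * Zeros of coercive vector fields *)

Section Zeros.
Context {R : realType} {k : nat}.
Implicit Types (F : 'I_k -> 'rV[R]_k -> R) (x : 'rV[R]_k).

Definition cube (L : R) : set 'rV[R]_k := [set x | forall j, `|x 0 j| <= L].

Lemma cube_compact L : compact (cube L).
Proof.
rewrite (_ : cube L = [set v : 'rV[R]_k | forall i, v ord0 i \in `[- L, L]]).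
  by apply: (@rV_compact _ _ (fun=> `[- L, L]%classic)) => _; exact: segment_compact.
by apply/seteqP; split => x /= h i; have := h i; rewrite in_itv /= ler_norml.
Qed.

Definition gridcoord (L : R) (p : nat) (q : 'I_k -> nat) : 'rV[R]_k :=
  \row_i (- L + 2 * L / p.+1%:R * (q i)%:R).

Lemma gridcoord_cube L p q : 0 < L -> (forall i, (q i <= p.+1)%N) ->
  cube L (gridcoord L p q).
Proof.
move=> L0 qp j; rewrite mxE ler_norml; have p0 : 0 < p.+1%:R :> R by [].
have h : (q j)%:R / p.+1%:R <= 1 :> R by rewrite ler_pdivrMr // mul1r ler_nat.
have h0 : 0 <= (q j)%:R / p.+1%:R :> R by rewrite divr_ge0.
have -> : 2 * L / p.+1%:R * (q j)%:R = 2 * L * ((q j)%:R / p.+1%:R) by ring.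
set a := _ / _ in h h0 *.
have La : 0 <= L * a by rewrite mulr_ge0 // ltW.
have La1 : 0 <= L * (1 - a) by rewrite mulr_ge0 ?subr_ge0 // ltW.
by apply/andP; split; lra.
Qed.

Lemma gridcoord_shift L p q A j : 0 < L ->
  `|gridcoord L p (shift A q) 0 j - gridcoord L p q 0 j| <= 2 * L / p.+1%:R.
Proof.
move=> L0; rewrite !mxE /shift natrD.
have d0 : 0 <= 2 * L / p.+1%:R by rewrite divr_ge0 // mulr_ge0 // ltW.
set d := 2 * L / _ in d0 *; have -> : - L + d * ((q j)%:R + (j \in A)%:R)
  - (- L + d * (q j)%:R) = d * (j \in A)%:R by ring.
rewrite ger0_norm; last by rewrite mulr_ge0.
by case: (j \in A); rewrite /= ?mulr1 ?mulr0.
Qed.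

(** The labels record the sign of the components of F at the grid points; the
    boundary values are imposed so that they hold even where F vanishes. *)
Lemma sign_change F L p : 0 < L ->
  (forall i x, cube L x -> x 0 i = - L -> F i x <= 0) ->
  (forall i x, cube L x -> x 0 i = L -> 0 <= F i x) ->
  exists2 z, cube L z & forall i, exists r s : 'rV[R]_k,
    [/\ forall j, `|r 0 j - z 0 j| <= 2 * L / p.+1%:R,
        forall j, `|s 0 j - z 0 j| <= 2 * L / p.+1%:R, F i r <= 0 & 0 <= F i s].
Proof.
move=> L0 Flo Fhi.
pose lab (a : nat) (q : 'I_k -> nat) : 'F_2 := if insub a is Some i then
  (if q i == 0%N then 0 else if q i == p.+1 then 1 else
    (0 < F i (gridcoord L p q))%R%:R) else 0.
have labE (i : 'I_k) q : lab i q = if q i == 0%N then 0 else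
    if q i == p.+1 then 1 else (0 < F i (gridcoord L p q))%R%:R.
  by rewrite /lab valK.
have [j q q0|j q qp|q qp qBC] := @kuhn k lab p.+1.
- by rewrite labE q0.
- by rewrite labE qp eqxx.
have qle A i : (shift A q i <= p.+1)%N.
  by rewrite /shift; case: (i \in A); rewrite ?addn1 ?addn0 // ltnW.
exists (gridcoord L p q).
  by apply: gridcoord_cube => // i; rewrite ltnW.
move=> i; have [B [C [iB iC]]] := qBC i.
exists (gridcoord L p (shift B q)), (gridcoord L p (shift C q)); split.
- by move=> j; exact: gridcoord_shift.
- by move=> j; exact: gridcoord_shift.
- move: iB; rewrite labE; case: eqP => [q0 _|_].
    apply: Flo; first exact: gridcoord_cube.
    by rewrite mxE q0 mulr0 addr0.
  by case: eqP => // _; case: ltP.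
- move: iC; rewrite labE; case: eqP => // _; case: eqP => [q1 _|_].
    apply: Fhi; first exact: gridcoord_cube.
    by rewrite mxE q1 mulfVK // mulrDl mul1r addKr.
  by case: ltP => // /ltW.
Qed.

(** A cluster point of cubes of vanishing size on which every component of F
    changes sign. *)
Lemma poincare_miranda F L : 0 < L -> (forall i, continuous (F i)) ->
  (forall i x, cube L x -> x 0 i = - L -> F i x <= 0) ->
  (forall i x, cube L x -> x 0 i = L -> 0 <= F i x) ->
  exists x, forall i, F i x = 0.
Proof.
move=> L0 cF Flo Fhi.
pose P p z := cube L z /\ forall i, exists r s : 'rV[R]_k,
    [/\ forall j, `|r 0 j - z 0 j| <= 2 * L / p.+1%:R,
        forall j, `|s 0 j - z 0 j| <= 2 * L / p.+1%:R, F i r <= 0 & 0 <= F i s].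
have /choice[z Pz] p : exists z, P p z.
  by have [z] := sign_change p L0 Flo Fhi; exists z.
have [x [_ clx]] : cube L `&` cluster (z @ \oo) !=set0.
  by apply: cube_compact; exists 0%N => // p _; exact: (Pz p).1.
exists x => i.
(* Infinitely many z p come close to x, and the grids get finer with p. *)
have near_pts e : 0 < e -> exists2 p, ball x e (z p) & 2 * L / p.+1%:R < e.
  move=> e0; have Le : 0 < e / (2 * L) by rewrite divr_gt0 // mulr_gt0.
  have [N _ HN] := near_infty_natSinv_lt (PosNum Le).
  have [y [[p Np zp] xy]] : [set z p | p in [set p | (N <= p)%N]] `&` ball x e !=set0.
    apply: clx; last exact: nbhsx_ballx.
    by exists N => // p /= Np; exists p.
  exists p; first by rewrite zp.
  have := HN p Np => /=; rewrite ltr_pdivlMr ?mulr_gt0 // mulrC.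
  by rewrite -div1r mulrA mulr1.
have ball2 e p (r : 'rV[R]_k) : ball x (e / 2) (z p) -> 2 * L / p.+1%:R < e / 2 ->
    (forall j, `|r 0 j - z p 0 j| <= 2 * L / p.+1%:R) -> ball x e r.
  move=> [e0 xz] Le rz; split; first by lra.
  move=> a j; rewrite !ord1; have := xz 0 j; rewrite /ball /= => xzj.
  have := rz j; rewrite distrC => rzj.
  rewrite (_ : x 0 j - r 0 j = (x 0 j - z p 0 j) + (z p 0 j - r 0 j)); last by ring.
  by rewrite (le_lt_trans (ler_normD _ _)) // (splitr e) ltrD // (le_lt_trans rzj).
apply/eqP; rewrite eq_le; apply/andP; split; rewrite leNgt; apply/negP => Fx.
  have /nbhs_ballP[e /= e0 He] : nbhs x [set y | 0 < F i y].
    exact: (cF i x _ (lt_nbhsr Fx)).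
  have [p xz Lp] := near_pts (e / 2) ltac:(lra).
  have [r [s [rz _ Fr _]]] := (Pz p).2 i.
  by have /= := He _ (ball2 _ _ _ xz Lp rz); lra.
have /nbhs_ballP[e /= e0 He] : nbhs x [set y | F i y < 0].
  exact: (cF i x _ (lt_nbhsl Fx)).
have [p xz Lp] := near_pts (e / 2) ltac:(lra).
have [r [s [_ sz _ Fs]]] := (Pz p).2 i.
by have /= := He _ (ball2 _ _ _ xz Lp sz); lra.
Qed.

Lemma continuous_sum (V : normedModType R) (I : finType) (T : topologicalType)
    (g : I -> T -> V) :
  (forall i, continuous (g i)) -> continuous (fun y => \sum_i g i y).
Proof.
move=> cg y; rewrite (_ : (fun y => _) = \sum_i g i).
  by apply: (big_ind (fun h : T -> V => {for y, continuous h})) => [|f h cf ch|i _];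
    [exact: cst_continuous|exact: continuousD|exact: cg].
by apply/funext => z; rewrite fct_sumE.
Qed.

Lemma dotv_continuous : continuous (fun x : 'rV[R]_k => dotv x x).
Proof.
apply: (@continuous_sum R^o) => i x.
by apply: continuousM; exact: coord_continuous.
Qed.

(** Adding to the i-th component a large multiple of max(0, x.x - rho) x_i makes
    the field point outwards on the faces of a large cube. It creates no zero
    outside the ball, since the product with x stays positive there. *)
Lemma coercive_zero F (rho : R) : (forall i, continuous (F i)) ->
  (forall x, rho < dotv x x -> 0 < \sum_i x 0 i * F i x) ->
  exists x, forall i, F i x = 0.
Proof.
move=> cF coF; pose L := `|rho| + 1.
have L1 : 1 <= L by rewrite /L lerDr.
have rhoL : rho + 1 <= L * L.
  by have := ler_norm rho; rewrite /L => h; have := normr_ge0 rho; nra.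
have /choice[M FM] i : exists M, 0 <= M /\ forall x, cube L x -> `|F i x| <= M.
  have /compact_bounded[M [_ HM]] : compact (F i @` cube L).
    apply: continuous_compact; last exact: cube_compact.
    by apply: continuous_subspaceT => x; exact: cF.
  exists (`|M| + 1); split => // x cx; apply: HM; last by exists x.
  by rewrite (le_lt_trans (ler_norm M)) // ltrDl.
(* M i bounds F i on the cube of half side L, and x.x - rho >= 1 on its faces. *)
pose H i x := F i x + M i * (Num.max 0 (dotv x x - rho) * x 0 i).
have dotL i x : `|x 0 i| = L -> 1 <= Num.max 0 (dotv x x - rho).
  move=> xi; rewrite le_max; apply/orP; right.
  suff : L * L <= dotv x x by lra.
  rewrite /dotv (bigD1 i) //= -xi -normrM ger0_norm -?expr2 ?sqr_ge0 //.
  by rewrite lerDl sumr_ge0 // => j _; rewrite -expr2 sqr_ge0.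
have [||i x cx xi|i x cx xi|x Hx] := @poincare_miranda H L.
- by lra.
- move=> i x; apply: (@continuousD _ R^o _ (F i) (fun x => M i * (Num.max 0 (dotv x x - rho) * x 0 i))); first exact: cF.
  apply: continuousM; first exact: cst_continuous.
  apply: continuousM; last exact: coord_continuous.
  apply: continuous_max; first exact: cst_continuous.
  by apply: continuousB; [exact: dotv_continuous|exact: cst_continuous].
- have [M0 /(_ x cx)] := FM i; rewrite ler_norml => /andP[_ Fi].
  have d1 : 1 <= Num.max 0 (dotv x x - rho) by apply: (dotL i); rewrite xi normrN ger0_norm //; lra.
  rewrite /H xi; have : 0 <= M i * (Num.max 0 (dotv x x - rho) * L - 1).
    by rewrite mulr_ge0 // subr_ge0 (le_trans L1) // ler_peMl //; lra.
  by lra.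
- have [M0 /(_ x cx)] := FM i; rewrite ler_norml => /andP[Fi _].
  have d1 : 1 <= Num.max 0 (dotv x x - rho) by apply: (dotL i); rewrite xi ger0_norm //; lra.
  rewrite /H xi; have : 0 <= M i * (Num.max 0 (dotv x x - rho) * L - 1).
    by rewrite mulr_ge0 // subr_ge0 (le_trans L1) // ler_peMl //; lra.
  by lra.
exists x; have [xrho|xrho] := leP (dotv x x) rho.
  by move=> i; have := Hx i; rewrite /H max_l ?subr_le0 // mul0r mulr0 addr0.
have := coF x xrho; rewrite ltNge => /negP[].
rewrite -oppr_ge0 -sumrN sumr_ge0 // => i _.
have -> : F i x = - (M i * (Num.max 0 (dotv x x - rho) * x 0 i)).
  by apply/eqP; rewrite -addr_eq0; apply/eqP/Hx.
have -> : - (x 0 i * - (M i * (Num.max 0 (dotv x x - rho) * x 0 i))) =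
  M i * (Num.max 0 (dotv x x - rho) * x 0 i ^+ 2) by ring.
rewrite mulr_ge0 ?(FM i).1 // mulr_ge0 ?sqr_ge0 //.
by rewrite le_max lexx.
Qed.

End Zeros.

(** * Semidefinite forms, Galerkin systems and multipliers *)

Section LinearAlgebra.
Context {R : realType}.

Lemma scalar0 (V : lmodType R) (h : V -> R) : scalar h -> h 0 = 0.
Proof. by move=> hl; have := hl (-1) 0 0; rewrite scaler0 addr0 mulN1r addNr. Qed.

Lemma scalarZ (V : lmodType R) (h : V -> R) : scalar h ->
  forall c x, h (c *: x) = c * h x.
Proof. by move=> hl c x; rewrite -[c *: x]addr0 hl scalar0 // addr0. Qed.

Lemma scalar_sum (V : lmodType R) (h : V -> R) (I : finType) (c : I -> R)
    (x : I -> V) : scalar h -> h (\sum_i c i *: x i) = \sum_i c i * h (x i).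
Proof.
move=> hl; elim/big_rec2: _ => [|i y z _ <-]; first exact: scalar0.
exact: hl.
Qed.

Lemma scalarB (V : lmodType R) (h : V -> R) : scalar h ->
  forall x y, h (x - y) = h x - h y.
Proof. by move=> hl x y; rewrite addrC -scaleN1r hl mulN1r addrC. Qed.

Lemma scalarDl (V : lmodType R) (a : R) (L1 L2 : V -> R) : scalar L1 -> scalar L2 ->
  scalar (fun v => a * L1 v + L2 v).
Proof. by move=> l1 l2 c x y; rewrite l1 l2; ring. Qed.

Lemma scalar_sumf (V : lmodType R) (I : finType) (P : pred I) (L : I -> V -> R) :
  (forall i, scalar (L i)) -> scalar (fun v => \sum_(i | P i) L i v).
Proof.
move=> Ll c x y; rewrite mulr_sumr -big_split /=.
by apply: eq_bigr => i _; exact: Ll.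
Qed.

Definition subspace (V : lmodType R) (P : V -> Prop) :=
  P 0 /\ forall c x y, P x -> P y -> P (c *: x + y).

Lemma subspace_sum (V : lmodType R) (P : V -> Prop) (I : finType) (c : I -> R)
    (x : I -> V) : subspace P -> (forall i, P (x i)) -> P (\sum_i c i *: x i).
Proof.
move=> [P0 PD] Px; elim/big_rec: _ => // i y _ Py; exact: PD.
Qed.

Definition psd_form (V : lmodType R) (s : V -> V -> R) :=
  [/\ forall x y, s x y = s y x, forall y, scalar (s ^~ y) & forall x, 0 <= s x x].

(** The quadratic polynomial t |-> s(t v + w, t v + w) is nonnegative; when its
    leading coefficient is 0, so is the linear one. *)
Lemma psd_null (V : lmodType R) (s : V -> V -> R) : psd_form s ->
  forall v w, s v v = 0 -> s v w = 0.
Proof.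
move=> [sC sl s0] v w vv; apply/eqP/negP => /negP b0.
have sr x : scalar (s x) by move=> c y z; rewrite !(sC x) sl.
have := s0 (- (s w w + 1) / (2 * s v w) *: v + w); rewrite sl !sr vv (sC w v).
(* This t makes the value of the polynomial equal to -1. *)
set t := _ / _; suff : t * (2 * s v w) = - (s w w + 1) by lra.
by rewrite mulfVK // mulf_neq0.
Qed.

(** Gram-Schmidt modulo the kernel of s. A family orthonormal for s is
    linearly independent, so there is one of maximal size, and a vector that it
    does not span modulo the kernel would extend it. *)
Lemma orthonormal_basis N (s : 'rV[R]_N -> 'rV[R]_N -> R) (P : 'rV[R]_N -> Prop) :
  psd_form s -> subspace P ->
  exists k (e : 'I_k -> 'rV[R]_N),
  [/\ forall i, P (e i), forall i j, s (e i) (e j) = (i == j)%:R &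
      forall v, P v -> let w := v - \sum_i s v (e i) *: e i in s w w = 0].
Proof.
move=> [sC sl s0] Ps.
have sr x : scalar (s x) by move=> c y z; rewrite !(sC x) sl.
pose fam k (e : 'I_k -> 'rV[R]_N) :=
  (forall i, P (e i)) /\ forall i j, s (e i) (e j) = (i == j)%:R.
have famN k e : fam k e -> (k <= N)%N.
  move=> [_ eo]; pose B := \matrix_(i, j) s (delta_mx 0 i : 'rV[R]_N) (e j).
  apply: (@mulmx1_min _ _ _ (\matrix_i e i) B).
  apply/matrixP => i j; rewrite !mxE -eo [in RHS](row_sum_delta (e i)).
  by rewrite (scalar_sum _ _ (sl _)); apply: eq_bigr => a _; rewrite !mxE.
have fam0 : exists k, `[< exists e, fam k e >].
  by exists 0%N; apply/asboolP; exists (fun=> 0); split => -[].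
have famB k : `[< exists e, fam k e >] -> (k <= N)%N.
  by move=> /asboolP[e /famN].
case: (ex_maxnP fam0 famB) => k /asboolP[e [Pe eo]] kmax.
exists k, e; split => // v Pv; set w := v - _; cbn zeta.
have Pw : P w.
  rewrite /w addrC -scaleN1r; apply: Ps.2 => //; exact: subspace_sum.
have we i : s w (e i) = 0.
  rewrite /w (scalarB (sl _)) (scalar_sum _ _ (sl _)) (bigD1 i) //= eo eqxx mulr1 big1.
    by rewrite addr0 subrr.
  by move=> j /negPf ji; rewrite eo ji mulr0.
apply/eqP/negP => /negP ww0.
have ww : 0 < s w w by rewrite lt_neqAle eq_sym ww0 s0.
pose w' := (Num.sqrt (s w w))^-1 *: w.
have w'e i : s w' (e i) = 0 by rewrite /w' (scalarZ (sl _)) we mulr0.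
have w'w' : s w' w' = 1.
  rewrite /w' (scalarZ (sl _)) (scalarZ (sr _)) mulrA -invfM -expr2 sqr_sqrtr ?s0 //.
  by rewrite mulVf // gt_eqF.
have := kmax k.+1; rewrite ltnn => /(_ _)/negP; apply => //; apply/asboolP.
exists (fun i => if unlift ord_max i is Some j then e j else w'); split.
  move=> i; case: unliftP => [j _|_]; first exact: Pe.
  by rewrite -[w']addr0; apply: Ps.2 => //; exact: Ps.1.
move=> i j; case: unliftP => [a ->|->]; case: unliftP => [b ->|->].
- by rewrite eo (inj_eq lift_inj).
- by rewrite sC w'e eq_sym (negPf (neq_lift _ _)).
- by rewrite w'e (negPf (neq_lift _ _)).
- by rewrite w'w' eqxx.
Qed.

(** In coordinates with respect to an orthonormal family of s the equation
    asks for a zero of a vector field F with y.F(y) >= y.y - gam.y. *)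
Lemma galerkin N (P : 'rV[R]_N -> Prop) (s T : 'rV[R]_N -> 'rV[R]_N -> R)
    (g : 'rV[R]_N -> R) :
  psd_form s -> subspace P -> scalar g -> (forall x, scalar (T x)) ->
  (forall v, continuous (T ^~ v)) -> (forall x, P x -> 0 <= T x x) ->
  (forall v, s v v = 0 -> g v = 0 /\ forall x, T x v = 0) ->
  exists2 x, P x & forall v, P v -> s x v + T x v = g v.
Proof.
move=> sP Ps gl Tl Tc T0 null; have [sC sl s0] := sP.
have sr x : scalar (s x) by move=> c y z; rewrite !(sC x) sl.
have [k [e [Pe eo ebasis]]] := orthonormal_basis sP Ps.
pose X (y : 'rV[R]_k) := \sum_i y 0 i *: e i.
have PX y : P (X y) by exact: subspace_sum.
have sX y i : s (X y) (e i) = y 0 i.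
  rewrite /X (scalar_sum _ _ (sl _)) (bigD1 i) //= eo eqxx mulr1 big1 ?addr0 //.
  by move=> j /negPf ji; rewrite eo ji mulr0.
have cX : continuous X.
  apply: continuous_sum => i y.
  by apply: (@cvgZr_tmp R _ _ (nbhs y) _ (fun z : 'rV[R]_k => z 0 i)); exact: (@coord_continuous R 1 k 0 i y).
pose F i y := s (X y) (e i) + T (X y) (e i) - g (e i).
pose gam : 'rV[R]_k := \row_i g (e i).
have [|y ylarge|y Fy] := @coercive_zero R k F (dotv gam gam).
- move=> i y; apply: (@continuousB _ R^o _ (fun z => s (X z) (e i) + T (X z) (e i))
    (fun=> g (e i))); last exact: cst_continuous.
  apply: (@continuousD _ R^o _ (fun z => s (X z) (e i)) (fun z => T (X z) (e i))).
    rewrite (_ : (fun z => _) = fun z : 'rV[R]_k => z 0 i).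
      exact: coord_continuous.
    by apply/funext => z; exact: sX.
  by apply: (@continuous_comp _ _ _ X (T ^~ (e i))); [exact: cX|exact: Tc].
- have -> : \sum_i y 0 i * F i y = dotv y y + T (X y) (X y) - dotv gam y.
    have -> : T (X y) (X y) = \sum_i y 0 i * T (X y) (e i).
      by rewrite {2}/X (scalar_sum _ _ (Tl _)).
    rewrite /dotv -sumrN -!big_split /=.
    by apply: eq_bigr => i _; rewrite /F sX mxE; ring.
  have TX : 0 <= T (X y) (X y) by exact: T0.
  suff : dotv gam y < dotv y y by lra.
  have : 0 <= dotv (y - gam) (y - gam).
    by rewrite /dotv sumr_ge0 // => i _; rewrite -expr2 sqr_ge0.
  have -> : dotv (y - gam) (y - gam) = dotv y y - 2 * dotv gam y + dotv gam gam.
    rewrite /dotv mulr_sumr -sumrN -!big_split /=.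
    by apply: eq_bigr => i _; rewrite !mxE; ring.
  by lra.
exists (X y) => // v Pv; set w := v - \sum_i s v (e i) *: e i.
have ww : s w w = 0 by exact: ebasis.
have vE : v = \sum_i s v (e i) *: e i + w by rewrite /w addrC subrK.
have [gw Tw] := null w ww.
have sw x : s x w = 0 by rewrite sC; exact: psd_null.
have add (h : 'rV[R]_N -> R) : scalar h -> h w = 0 ->
    h v = \sum_i s v (e i) * h (e i).
  move=> hl hw; rewrite {1}vE -[X in X + w]scale1r hl mul1r hw addr0.
  exact: scalar_sum.
rewrite (add _ (sr _) (sw _)) (add _ (Tl _) (Tw _)) (add _ gl gw) -big_split /=.
apply: eq_bigr => i _; rewrite -mulrDr; congr (_ * _).
by apply/eqP; rewrite -subr_eq0; apply/eqP; exact: Fy.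
Qed.

Lemma subspace_spanned N (P : 'rV[R]_N -> Prop) : subspace P ->
  exists k (e : 'I_k -> 'rV[R]_N), (forall i, P (e i)) /\
    forall v, P v -> exists c : 'I_k -> R, v = \sum_i c i *: e i.
Proof.
move=> Ps; have dotP : psd_form (@dotv R N).
  split=> [x y|y c u v|x].
  - by apply: eq_bigr => i _; rewrite mulrC.
  - rewrite /dotv mulr_sumr -big_split /=.
    by apply: eq_bigr => i _; rewrite !mxE; ring.
  - by rewrite sumr_ge0 // => i _; rewrite -expr2 sqr_ge0.
have [k [e [Pe _ eb]]] := orthonormal_basis dotP Ps.
exists k, e; split => // v Pv; exists (fun i => dotv v (e i)).
have /eqP := eb v Pv; set w := v - _ => /=; rewrite /dotv psumr_eq0; last first.
  by move=> i _; rewrite -expr2 sqr_ge0.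
move=> /allP w0; apply/eqP; rewrite -subr_eq0 -/w; apply/eqP/rowP => i.
by have := w0 i (mem_index_enum i); rewrite /= mulf_eq0 orbb [RHS]mxE => /eqP.
Qed.

(** A row vector that vanishes on the right kernel of a matrix B is a linear
    combination of the rows of B, here b(., d_j) for a spanning family d_j. *)
Lemma multiplier N M (P : 'rV[R]_N -> Prop) (Q : 'rV[R]_M -> Prop)
    (b : 'rV[R]_N -> 'rV[R]_M -> R) (h : 'rV[R]_N -> R) :
  subspace P -> subspace Q -> (forall q, scalar (b ^~ q)) ->
  (forall v, P v -> forall c q q', b v (c *: q + q') = c * b v q + b v q') ->
  scalar h -> (forall v, P v -> (forall q, Q q -> b v q = 0) -> h v = 0) ->
  exists2 q, Q q & forall v, P v -> h v = b v q.
Proof.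
move=> Ps Qs bl br hl h0.
have [k [e [Pe eP]]] := subspace_spanned Ps.
have [k' [d [Qd dQ]]] := subspace_spanned Qs.
pose B := \matrix_(j, i) b (e i) (d j).
pose H := \row_i h (e i).
have /submxP[y Hy] : (H <= B)%MS.
  rewrite submxE; apply/eqP/rowP => j; rewrite !mxE.
  pose v := \sum_i cokermx B i j *: e i.
  rewrite -[RHS](h0 v) ?(scalar_sum _ _ hl) //.
  - by apply: eq_bigr => i _; rewrite !mxE mulrC.
  - exact: subspace_sum.
  move=> q /dQ[c ->]; have bv : scalar (b v) by apply: br; exact: subspace_sum.
  rewrite (scalar_sum _ _ bv) big1 // => a _.
  have : (B *m cokermx B) a j = 0 by rewrite mulmx_coker mxE.
  rewrite mxE /v (scalar_sum _ _ (bl _)) => Ba.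
  apply/eqP; rewrite mulf_eq0; apply/orP; right; apply/eqP.
  by rewrite -[RHS]Ba; apply: eq_bigr => i _; rewrite !mxE mulrC.
exists (\sum_j y 0 j *: d j); first exact: subspace_sum.
move=> v /[dup] Pv /eP[c vE].
have bv : scalar (b v) by exact: br.
rewrite (scalar_sum _ _ bv) vE (scalar_sum _ _ hl).
under [RHS]eq_bigr do rewrite (scalar_sum _ _ (bl _)) mulr_sumr.
rewrite exchange_big /=; apply: eq_bigr => i _.
have /rowP/(_ i) := Hy; rewrite !mxE => ->; rewrite mulr_sumr.
by apply: eq_bigr => j _; rewrite !mxE; ring.
Qed.

End LinearAlgebra.

(** * Polynomials as functions on R^n *)

Section MPoly.
Context {R : realType} {n : nat}.
Implicit Types (p q : mpoly n R) (x : 'rV[R]_n).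

(** Polynomials are generated as an algebra by constants and variables. *)
Lemma mpoly_alg_ind (Q : mpoly n R -> Prop) :
  (forall c, Q (mpolyC n c)) -> (forall i, Q (mpolyX R (mnm1 i))) ->
  (forall p q, Q p -> Q q -> Q (p + q)) ->
  (forall p q, Q p -> Q q -> Q (p * q)) -> forall p, Q p.
Proof.
move=> QC QX QD QM p; rewrite (mpolyE p).
have Q0 : Q 0 by rewrite -[0]mpolyC0.
have Q1 : Q 1 by rewrite -mpolyC1.
apply: (big_ind Q) => [||m _]; [exact: Q0|exact: QD|].
rewrite -mul_mpolyC mpolyXE_id; apply: (QM); first exact: QC.
apply: (big_ind Q) => [||i _]; [exact: Q1|exact: QM|]; elim: (m i) => [|k IH]; first by rewrite expr0.
by rewrite exprS; apply: (QM).
Qed.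

Lemma pevD p q x : pev (p + q) x = pev p x + pev q x.
Proof. exact: mevalD. Qed.
Lemma pevM p q x : pev (p * q) x = pev p x * pev q x.
Proof. exact: mevalM. Qed.
Lemma pevC c x : pev (mpolyC n c) x = c.
Proof. exact: mevalC. Qed.
Lemma pevX i x : pev (mpolyX R (mnm1 i)) x = x 0 i.
Proof. exact: mevalXU. Qed.
Lemma pevZ c p x : pev (c *: p) x = c * pev p x.
Proof. exact: mevalZ. Qed.
Lemma pev0 x : pev (0 : mpoly n R) x = 0.
Proof. exact: meval0. Qed.
Lemma pev_sum (I : finType) (F : I -> mpoly n R) x :
  pev (\sum_i F i) x = \sum_i pev (F i) x.
Proof.
by elim/big_rec2: _ => [|i y z _ <-]; rewrite ?pev0 ?pevD.
Qed.

Lemma pev_ind (S : ('rV[R]_n -> R) -> Prop) :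
  (forall c, S (fun=> c)) -> (forall i, S (fun x => x 0 i)) ->
  (forall f g, S f -> S g -> S (fun x => f x + g x)) ->
  (forall f g, S f -> S g -> S (fun x => f x * g x)) -> forall p, S (pev p).
Proof.
move=> SC SX SD SM; apply: mpoly_alg_ind => [c|i|p q Sp Sq|p q Sp Sq].
- by rewrite (_ : pev _ = fun=> c) //; apply/funext => x; rewrite pevC.
- by rewrite (_ : pev _ = fun x => x 0 i) //; apply/funext => x; rewrite pevX.
- by rewrite (_ : pev _ = fun x => pev p x + pev q x); [exact: SD|];
    apply/funext => x; rewrite pevD.
- by rewrite (_ : pev _ = fun x => pev p x * pev q x); [exact: SM|];
    apply/funext => x; rewrite pevM.
Qed.

Lemma pev_continuous p : continuous (pev p).
Proof.
apply: (@pev_ind (fun f => continuous f)) => [c|i|f g cf cg x|f g cf cg x].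
- exact: cst_continuous.
- exact: coord_continuous.
- by apply: (@continuousD _ R^o); [exact: cf|exact: cg].
- by apply: continuousM; [exact: cf|exact: cg].
Qed.

(** The restriction of p to the line through x in direction i. *)
Definition line_poly p x i : {poly R} :=
  mmap polyC (fun j => (x 0 j)%:P + (j == i)%:R *: 'X) p.

Lemma line_polyE p x i t :
  (line_poly p x i).[t] = pev p (x + t *: delta_mx 0 i).
Proof.
apply: (@mpoly_alg_ind (fun p => (line_poly p x i).[t] = _)) => {p} [c|j|p q|p q].
- by rewrite /line_poly mmapC hornerC pevC.
- rewrite /line_poly mmapX mmap1U pevX !mxE /= hornerD hornerC hornerZ hornerX.
  by rewrite mulrC.
- by rewrite /line_poly rmorphD /= hornerD pevD => -> ->.
- by rewrite /line_poly rmorphM /= hornerM pevM => -> ->.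
Qed.

Lemma line_poly_deriv p x i : (line_poly p x i)^`() = line_poly (mderiv i p) x i.
Proof.
apply: (@mpoly_alg_ind (fun p => (line_poly p x i)^`() = _)) => {p} [c|j|p q|p q].
- by rewrite /line_poly mderivC mmapC derivC rmorph0.
- rewrite /line_poly mmapX mmap1U mderivX derivD derivC derivZ derivX add0r.
  rewrite mnm1E; case: (eqVneq j i) => [->|]; rewrite /= ?scale1r ?scale0r ?rmorph0 //.
  rewrite (_ : mnm_sub _ _ = mnm0) ?mpolyX0 ?rmorph1 //.
  by apply/mnmP => a; rewrite mnmBE mnm0E subnn.
- by rewrite /line_poly mderivD !rmorphD /= derivD => -> ->.
- by rewrite /line_poly mderivM !(rmorphM, rmorphD) /= derivM => -> ->.
Qed.

Lemma poly_small_roots (p : {poly R}) (eps : R) : 0 < eps ->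
  (forall t, 0 < t -> t < eps -> p.[t] = 0) -> p = 0.
Proof.
move=> e0 p0; pose s := [seq eps / k.+2%:R | k <- iota 0 (size p)].
apply: (@roots_geq_poly_eq0 _ _ s).
- apply/allP => _ /mapP[k _ ->]; apply/rootP/p0; first by rewrite divr_gt0.
  by rewrite ltr_pdivrMr // ltr_pMr // (ltr_nat _ 1).
- rewrite map_inj_uniq ?iota_uniq // => a b /(mulfI (lt0r_neq0 e0))/invr_inj/eqP.
  by rewrite eqr_nat => /eqP[].
- by rewrite size_map size_iota.
Qed.

Lemma msize_mderiv_lt p i : p != 0 -> (msize (mderiv i p) < msize p)%N.
Proof.
rewrite -mpoly.msize_poly_eq0 -lt0n => p0; rewrite [X in (X < _)%N]msizeE big_seq.
elim/big_ind: _ => // [a b ha hb|m]; first by rewrite gtn_max ha hb.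
rewrite mcoeff_msupp mcoeff_deriv -mulr_natr mulf_eq0 negb_or -mcoeff_msupp.
by move=> /andP[/msize_mdeg_lt]; rewrite mdegD mdeg1 addn1.
Qed.

(** Induction on the degree: the partial derivatives of p also vanish on the
    box, hence are zero, and p is constant. *)
Lemma mpoly_box0 p (a : 'rV[R]_n) (d : R) : 0 < d ->
  (forall x, (forall i, `|x 0 i - a 0 i| < d) -> pev p x = 0) -> p = 0.
Proof.
move=> d0; have [k] := ubnP (msize p); elim: k p => // k IHk p pk p0.
have dp0 i : mderiv i p = 0.
  have [->|pn0] := eqVneq p 0; first by rewrite mderiv0.
  apply: IHk => [|x xa].
    by rewrite (leq_trans (msize_mderiv_lt i pn0)) // -ltnS.
  have xi : 0 < d - `|x 0 i - a 0 i| by rewrite subr_gt0.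
  have L0 : line_poly p x i = 0.
    apply: (poly_small_roots xi) => t t0 tx; rewrite line_polyE; apply: p0 => j.
    rewrite !mxE /=; case: eqVneq => [->|_]; last by rewrite mulr0 addr0.
    rewrite mulr1 addrAC (le_lt_trans (ler_normD _ _)) // (gtr0_norm t0).
    by move: tx; lra.
  have := line_polyE (mderiv i p) x i 0.
  by rewrite scale0r addr0 -line_poly_deriv L0 deriv0 horner0 => <-.
have pC : p = mpolyC n (mcoeff mnm0 p).
  apply/mpolyP => m; rewrite mcoeffC; case: eqVneq => [->|m0]; first by rewrite mulr1.
  rewrite mulr0; have [i mi] : exists i, m i != 0%N.
    apply/existsP; apply: contraR m0 => /existsPn m0.
    by apply/eqP/mnmP => i; rewrite mnm0E; apply/eqP; have := m0 i; rewrite negbK.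
  have := congr1 (mcoeff (mnm_sub m (mnm1 i))) (dp0 i); rewrite mcoeff_deriv mcoeff0.
  rewrite submK ?lep1mP // => /eqP; rewrite -mulr_natr mulf_eq0 => /orP[/eqP //|].
  by rewrite pnatr_eq0.
have c0 : mcoeff mnm0 p = 0.
  by rewrite -(pevC (mcoeff mnm0 p) a) -pC; apply: p0 => i; rewrite subrr normr0.
by rewrite pC c0 mpolyC0.
Qed.
End MPoly.

(** * Lebesgue measure of boxes *)

Lemma measurable_forall d (T : measurableType d) (I : finType) (A : I -> set T) :
  (forall i, measurable (A i)) -> measurable [set t | forall i, A i t].
Proof.
move=> mA; rewrite (_ : mkset _ = \bigcap_(i in [set: I]) A i).
  exact: fin_bigcap_measurable.
by apply/seteqP; split => [t h i _|t h i]; apply: h.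
Qed.

Section BoxMeasure.
Context {R : realType}.
Local Notation RT := (measurableTypeR R).

Definition tbox d (a b : 'I_d -> R) : set (d.-tuple RT) :=
  [set t | forall i, (a i <= tnth t i <= b i)%R].

Lemma measurable_tbox d (a b : 'I_d -> R) : measurable (tbox a b).
Proof.
apply: (@measurable_forall _ _ _ (fun i t => (a i <= tnth t i <= b i)%R)) => i.
rewrite (_ : (fun _ => _) = (fun t => tnth t i) @^-1` `[a i, b i]).
  rewrite -[X in measurable X]setTI.
  by apply: (@measurable_tnth _ RT d i measurableT).
by apply/seteqP; split => t /=; rewrite in_itv.
Qed.

(** The measure is built by adding one coordinate at a time, so this is an
    iterated product. *)
Lemma lebesgue_tuple_box d (a b : 'I_d -> R) : (forall i, a i <= b i) ->
  lebesgue_tuple d (tbox a b) = (\prod_i (b i - a i))%:E.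
Proof.
elim: d a b => [|d IHd] a b ab.
  by rewrite big_ord0 /= diracE mem_set // => -[].
rewrite /= /lebesgue_cons /pushforward.
rewrite (_ : _ @^-1` _ = `[a ord0, b ord0] `*`
    tbox (fun i => a (lift ord0 i)) (fun i => b (lift ord0 i))).
  rewrite product_measure1E ?measurable_itv //; last exact: measurable_tbox.
  rewrite IHd // big_ord_recl EFinM; congr (_ * _)%E.
  rewrite -[LHS]/(lebesgue_measure `[a ord0, b ord0]%classic).
  rewrite lebesgue_measure_itv /= lte_fin; case: ltP => // ba.
  by rewrite (@le_anti _ _ (b ord0) (a ord0)) ?subrr // ba ab.
apply/seteqP; split => -[x t] /=; rewrite in_itv /=.
  move=> h; split; first by have := h ord0; rewrite tnth0.
  by move=> i; have := h (lift ord0 i); rewrite tnthS.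
move=> [h0 h] i; case: (unliftP ord0 i) => [j ->|->]; last by rewrite tnth0.
by rewrite tnthS; exact: h.
Qed.

End BoxMeasure.

(** * Locally bounded Borel functions *)

Section Admissible.
Context {R : realType} {n : nat}.
Local Notation RT := (measurableTypeR R).
Implicit Types f g : 'rV[R]_n -> R.

(** The class of integrands: Borel functions bounded on bounded sets. It is an
    algebra containing polynomials and the powers of the speed, and its
    members are integrable over every cell and every face. *)
Definition admissible g :=
  measurable_fun [set: n.-tuple RT] (g \o @vec_of_tuple R n) /\
  forall B, exists C, forall x, cube B x -> `|g x| <= C.

Lemma admissible_cst c : admissible (fun=> c).
Proof. by split => [|B]; [exact: measurable_cst|exists `|c|]. Qed.

Lemma admissible_coord i : admissible (fun x => x 0 i).
Proof.
split => [|B]; last by exists B => x; apply.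
rewrite (_ : _ \o _ = fun t : n.-tuple RT => tnth t i); first exact: measurable_tnth.
by apply/funext => t; rewrite /= mxE.
Qed.

Lemma admissibleD f g : admissible f -> admissible g -> admissible (fun x => f x + g x).
Proof.
move=> [mf bf] [mg bg]; split => [|B]; first exact: measurable_funD.
have [C HC] := bf B; have [D HD] := bg B; exists (C + D) => x xB.
by rewrite (le_trans (ler_normD _ _)) // lerD ?HC ?HD.
Qed.

Lemma admissibleM f g : admissible f -> admissible g -> admissible (fun x => f x * g x).
Proof.
move=> [mf bf] [mg bg]; split => [|B]; first exact: measurable_funM.
have [C HC] := bf B; have [D HD] := bg B; exists (C * D) => x xB.
by rewrite normrM ler_pM ?HC ?HD.
Qed.

Lemma admissible_sum (I : finType) (F : I -> 'rV[R]_n -> R) :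
  (forall i, admissible (F i)) -> admissible (fun x => \sum_i F i x).
Proof.
move=> nF; rewrite (_ : (fun x => _) = \sum_i F i); last first.
  by apply/funext => x; rewrite fct_sumE.
apply: (big_ind admissible) => //; first exact: admissible_cst.
by move=> f g; exact: admissibleD.
Qed.

Lemma admissible_pev p : admissible (pev p).
Proof.
apply: (@pev_ind R n admissible) => *; [exact: admissible_cst|exact: admissible_coord|exact: admissibleD|
  exact: admissibleM].
Qed.

Lemma admissible_dotv k (u v : 'rV[R]_n -> 'rV[R]_k) : (forall i, admissible (fun x => u x 0 i)) ->
  (forall i, admissible (fun x => v x 0 i)) -> admissible (fun x => dotv (u x) (v x)).
Proof. by move=> nu nv; apply: admissible_sum => i; exact: admissibleM. Qed.

Lemma admissible_powR_enorm k (u : 'rV[R]_n -> 'rV[R]_k) r : 0 <= r ->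
  (forall i, admissible (fun x => u x 0 i)) -> admissible (fun x => enorm (u x) `^ r).
Proof.
move=> r0 nu; have [mf bf] := admissible_dotv nu nu; split => [|B].
  have ms := measurableT_comp (continuous_measurable_fun (@sqrt_continuous R)) mf.
  exact: (measurableT_comp (@measurable_powR R r) ms).
have [C HC] := bf B; exists (Num.sqrt C `^ r) => x xB.
rewrite ger0_norm ?powR_ge0 // ge0_ler_powR ?nnegrE ?sqrtr_ge0 //.
by rewrite ler_wsqrtr // (le_trans (ler_norm _) (HC _ xB)).
Qed.

End Admissible.

(** * Barycentric coordinates of a simplex *)

Section Barycentric.
Context {R : realType} {n : nat} {I : finType}.
Variables (P : I -> 'rV[R]_n) (s : {set I}).
Hypotheses (sn : #|s| = n.+1) (sP : aff_indep P s).

Definition vtx (a : 'I_n.+1) : I := enum_val (cast_ord (esym sn) a).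

Lemma vtx_inj : injective vtx.
Proof. by move=> a b /enum_val_inj /cast_ord_inj. Qed.

Lemma vtx_in a : vtx a \in s.
Proof. exact: enum_valP. Qed.

(** The rows are the vertices of the simplex in homogeneous coordinates; affine
    independence says that this matrix is invertible. *)
Definition vertex_mx : 'M[R]_n.+1 :=
  \matrix_(a, j) (row_mx (1%:M : 'M[R]_1) (P (vtx a)) : 'M[R]_(1, 1 + n)) 0 j.

Lemma mul_vertex_mx (v : 'rV[R]_n.+1) : v *m vertex_mx =
  row_mx ((\sum_a v 0 a)%:M : 'M[R]_1) (\sum_a v 0 a *: P (vtx a)) :> 'M[R]_(1, 1 + n).
Proof.
apply/rowP => j; rewrite mxE -[j]splitK; case: fintype.split => i /=.
  rewrite row_mxEl ord1 !mxE mulr1n; apply: eq_bigr => a _.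
  by rewrite mxE (row_mxEl _ _ _ 0) mxE mulr1.
rewrite row_mxEr summxE; apply: eq_bigr => a _.
by rewrite [RHS]mxE [X in _ * X]mxE row_mxEr.
Qed.

Lemma sum_vtx (V : nmodType) (F : I -> V) :
  \sum_(j in s) F j = \sum_a F (vtx a).
Proof.
rewrite big_enum_val (reindex (cast_ord (esym sn))) //.
by exists (cast_ord sn) => a _; rewrite cast_ordKV || rewrite cast_ordK.
Qed.

Lemma vertex_mx_unit : vertex_mx \in unitmx.
Proof.
rewrite -row_free_unit; apply: inj_row_free => v; rewrite mul_vertex_mx => v0.
have /eq_row_mx[s0' p0] :
    row_mx ((\sum_a v 0 a)%:M : 'M[R]_1) (\sum_a v 0 a *: P (vtx a)) = row_mx 0 0.
  by rewrite row_mx0.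
have s0 : \sum_a v 0 a = 0.
  by have /matrixP/(_ 0 0) := s0'; rewrite !mxE mulr1n.
pose lam j := \sum_(a | vtx a == j) v 0 a.
have lamE a : lam (vtx a) = v 0 a.
  by rewrite /lam (big_pred1 a) // => b; rewrite (inj_eq vtx_inj).
have lam0 j : j \notin s -> lam j = 0.
  by move=> js; rewrite /lam big1 // => a /eqP aj; rewrite -aj vtx_in in js.
have sumE (V : lmodType R) (F : I -> V) :
    \sum_j lam j *: F j = \sum_a v 0 a *: F (vtx a).
  rewrite (bigID (mem s)) /= [X in _ + X]big1 => [|j js]; last by rewrite lam0 ?scale0r.
  by rewrite addr0 sum_vtx; apply: eq_bigr => a _; rewrite lamE.
apply/rowP => a; rewrite mxE -lamE; apply: (sP lam0); last by rewrite sumE.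
have := sumE R^o (fun=> 1); rewrite /= => h.
rewrite (eq_bigr (fun j => lam j *: (1 : R^o))) ?h => [|j _]; last first.
  by rewrite /GRing.scale /= mulr1.
by rewrite -[RHS]s0; apply: eq_bigr => b _; rewrite /GRing.scale /= mulr1.
Qed.

Definition bary (x : 'rV[R]_n) : 'rV[R]_n.+1 :=
  (row_mx (1%:M : 'M[R]_1) x : 'M[R]_(1, 1 + n)) *m invmx vertex_mx.

Lemma baryE (v : 'rV[R]_n.+1) (x : 'rV[R]_n) : \sum_a v 0 a = 1 -> \sum_a v 0 a *: P (vtx a) = x ->
  bary x = v.
Proof.
move=> v1 vx; rewrite /bary; apply: (canLR (mulmxK vertex_mx_unit)).
by rewrite mul_vertex_mx v1 vx.
Qed.

Lemma bary_sum x : \sum_a bary x 0 a = 1 /\ \sum_a bary x 0 a *: P (vtx a) = x.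
Proof.
have := mul_vertex_mx (bary x); rewrite /bary mulmxKV ?vertex_mx_unit // => /eq_row_mx[h1 h2].
split; last exact/esym.
by have /matrixP/(_ 0 0) := h1; rewrite !mxE !mulr1n => /esym.
Qed.

Lemma bary_affine a : exists c (w : 'I_n -> R),
  forall x, bary x 0 a = c + \sum_i x 0 i * w i.
Proof.
exists (invmx vertex_mx (0 : 'I_(1 + n)) a), (fun i => invmx vertex_mx (rshift 1 i) a) => y.
rewrite /bary mxE (@big_split_ord _ _ _ 1 n) /= big_ord1; congr (_ + _).
  by rewrite row_mxEl mxE mul1r; congr (invmx _ _ _); apply/val_inj.
by apply: eq_bigr => i _; rewrite row_mxEr.
Qed.

(** A simplex is an intersection of half-spaces, which gives its measurability. *)
Lemma hullE : hull P s = [set x | forall a, 0 <= bary x 0 a].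
Proof.
apply/seteqP; split => [x [lam [l0 ls l1 ->]] a|x x0].
  have sumE (V : lmodType R) (F : I -> V) :
      \sum_j lam j *: F j = \sum_a lam (vtx a) *: F (vtx a).
    rewrite (bigID (mem s)) /= [X in _ + X]big1 => [|j js]; last by rewrite ls ?scale0r.
    by rewrite addr0 sum_vtx.
  rewrite (@baryE (\row_a lam (vtx a))) ?mxE ?l0 //.
    rewrite -l1 (bigID (mem s)) /= [X in _ = _ + X]big1 => [|j js]; last by rewrite ls.
    by rewrite addr0 sum_vtx; apply: eq_bigr => b _; rewrite mxE.
  by rewrite sumE; apply: eq_bigr => b _; rewrite mxE.
have [b1 bx] := bary_sum x.
exists (fun j => \sum_(a | vtx a == j) bary x 0 a); split.
- by move=> j; rewrite sumr_ge0.
- by move=> j js; rewrite big1 // => a /eqP aj; rewrite -aj vtx_in in js.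
- by rewrite -b1 [RHS](partition_big vtx predT).
- rewrite -{1}bx (partition_big vtx predT) //=; apply: eq_bigr => j _.
  by rewrite scaler_suml; apply: eq_bigr => a /eqP ->.
Qed.

(** The barycentre has positive barycentric coordinates, and these are affine. *)
Lemma hull_box : exists (x0 : 'rV[R]_n) (d : R), 0 < d /\
  forall x : 'rV[R]_n, (forall i, `|x 0 i - x0 0 i| <= d) -> hull P s x.
Proof.
pose v : 'rV[R]_n.+1 := const_mx (n.+1%:R^-1).
pose x0 := \sum_a v 0 a *: P (vtx a).
have bx0 a : bary x0 0 a = n.+1%:R^-1.
  rewrite (@baryE v) ?mxE // (eq_bigr (fun=> n.+1%:R^-1)) => [|b _].
    by rewrite sumr_const card_ord -(mulr_natr n.+1%:R^-1) mulVf // pnatr_eq0.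
  by rewrite mxE.
have /choice[cw cwE] a : exists cw : R * ('I_n -> R),
    forall x, bary x 0 a = cw.1 + \sum_i x 0 i * cw.2 i.
  by have [c [w cw]] := bary_affine a; exists (c, w).
(* S is a Lipschitz constant of all barycentric coordinates, made positive by 1. *)
pose S := 1 + \sum_a \sum_i `|(cw a).2 i|.
have S1 : 1 <= S.
  by rewrite lerDl sumr_ge0 // => a _; rewrite sumr_ge0.
have n0 : 0 < n.+1%:R :> R by [].
exists x0, (n.+1%:R^-1 / S); split.
  by rewrite divr_gt0 ?invr_gt0 // (lt_le_trans _ S1).
move=> x xd; rewrite hullE => a.
have -> : bary x 0 a = n.+1%:R^-1 + \sum_i (x 0 i - x0 0 i) * (cw a).2 i.
  rewrite -(bx0 a) !cwE -addrA -big_split /=; congr (_ + _).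
  by apply: eq_bigr => i _; ring.
rewrite addrC -[X in _ + X]opprK subr_ge0 lerNl.
apply: (le_trans (ler_norm _)); rewrite normrN.
apply: (le_trans (ler_norm_sum _ _ _)).
have : \sum_i `|(x 0 i - x0 0 i) * (cw a).2 i| <= n.+1%:R^-1 / S * \sum_i `|(cw a).2 i|.
  rewrite mulr_sumr; apply: ler_sum => i _.
  by rewrite normrM ler_wpM2r.
move=> /le_trans; apply; rewrite mulrAC ler_pdivrMr ?(lt_le_trans _ S1) //.
rewrite ler_wpM2l ?invr_ge0 //.
rewrite /S (bigD1 a) //= addrA (addrC 1) -addrA lerDl addr_ge0 //.
by rewrite sumr_ge0 // => b _; rewrite sumr_ge0.
Qed.

End Barycentric.

Lemma hull_bounded (R : realType) n (I : finType) (P : I -> 'rV[R]_n) (s : {set I}) :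
  exists B, hull P s `<=` cube B.
Proof.
exists (\sum_j `|P j|) => x [lam [l0 _ l1 ->]] i.
rewrite summxE (le_trans (ler_norm_sum _ _ _)) // ler_sum // => j _.
have lj : lam j <= 1.
  by rewrite -l1 (bigD1 j) //= lerDl sumr_ge0.
rewrite mxE normrM (ger0_norm (l0 j)).
have Pj : `|P j 0 i| <= `|P j|.
  rewrite [leRHS]/Num.Def.normr /= mx_normrE; apply/bigmax_geP; right => /=.
  by exists (0, i).
by rewrite (le_trans _ Pj) // ler_piMl.
Qed.

(** * Cell and face integrals as positive functionals *)

Section PosInt.
Context {R : realType} {n : nat}.
Local Notation RT := (measurableTypeR R).
Implicit Types f g : 'rV[R]_n -> R.

(** What the algebra of the scheme uses of an integral: linearity on
    admissible functions and positivity. *)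
Definition posint (J : ('rV[R]_n -> R) -> R) :=
  (forall c f g, admissible f -> admissible g -> J (fun x => c * f x + g x) = c * J f + J g) /\
  (forall f, (forall x, 0 <= f x) -> 0 <= J f).

Section Theory.
Variable J : ('rV[R]_n -> R) -> R.
Hypothesis Jp : posint J.

Lemma posint0 : J (fun=> 0) = 0.
Proof.
rewrite -[RHS](addNr (J (fun=> 0))) -mulN1r.
rewrite -(Jp.1 (-1) _ _ (admissible_cst 0) (admissible_cst 0)); congr (J _).
by apply/funext => x; rewrite mulr0 addr0.
Qed.

Lemma posintZ c f : admissible f -> J (fun x => c * f x) = c * J f.
Proof.
move=> nf; rewrite -[RHS]addr0 -[X in _ + X]posint0 -(Jp.1 c _ _ nf (admissible_cst 0)).
by congr (J _); apply/funext => x; rewrite addr0.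
Qed.

Lemma posintD f g : admissible f -> admissible g -> J (fun x => f x + g x) = J f + J g.
Proof.
move=> nf ng; rewrite -[J f]mul1r -(Jp.1 1 _ _ nf ng).
by congr (J _); apply/funext => x; rewrite mul1r.
Qed.

Lemma posint_sum (I : finType) (F : I -> 'rV[R]_n -> R) : (forall i, admissible (F i)) ->
  J (fun x => \sum_i F i x) = \sum_i J (F i).
Proof.
move=> nF; rewrite (_ : (fun x => _) = \sum_i F i); last first.
  by apply/funext => x; rewrite fct_sumE.
suff [] : admissible (\sum_i F i) /\ J (\sum_i F i) = \sum_i J (F i) by [].
apply: (big_ind2 (fun f a => admissible f /\ J f = a)).
- by split; [exact: admissible_cst|exact: posint0].
- move=> f a g b [nf <-] [ng <-]; split; first exact: admissibleD.
  exact: posintD.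
- by move=> i _.
Qed.

(** Cauchy-Schwarz in the degenerate case. *)
Lemma posint_sqr_eq0 f g : admissible f -> admissible g ->
  J (fun x => f x * f x) = 0 -> J (fun x => f x * g x) = 0.
Proof.
move=> nf ng ff; apply/eqP/negP => /negP b0.
(* With this t the square of t f + g would have integral -1. *)
pose t := - (J (fun x => g x * g x) + 1) / (2 * J (fun x => f x * g x)).
have : 0 <= J (fun x => (t * f x + g x) * (t * f x + g x)).
  by apply: Jp.2 => x; rewrite -expr2 sqr_ge0.
rewrite (_ : (fun x => _) = fun x =>
    t * (t * (f x * f x) + 2 * (f x * g x)) + g x * g x);
  last by apply/funext => x; ring.
have nff := admissibleM nf nf; have nfg := admissibleM nf ng; have ngg := admissibleM ng ng.
have nfg2 := admissibleM (admissible_cst 2) nfg.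
rewrite (Jp.1 t _ _ (admissibleD (admissibleM (admissible_cst t) nff) nfg2) ngg).
rewrite (Jp.1 t _ _ nff nfg2) posintZ // ff mulr0 add0r.
rewrite {1}/t mulfVK ?mulf_neq0 // opprD addrAC addNr add0r.
by rewrite leNgt oppr_lt0 ltr01.
Qed.

End Theory.

Section Param.
Context d (T : measurableType d) (mu : {measure set T -> \bar R}) (D : set T).
Variables (Y : T -> n.-tuple RT) (B : R).
Hypotheses (mD : measurable D) (muD : (mu D < +oo)%E).
Hypotheses (mY : measurable_fun setT Y).
Hypothesis YB : forall t, D t -> cube B (vec_of_tuple (Y t)).

Lemma admissible_integrable g : admissible g ->
  mu.-integrable D (EFin \o (fun t => g (vec_of_tuple (Y t)))).
Proof.
move=> [mg bg]; apply: measurable_bounded_integrable => //.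
  exact: (measurable_funTS (measurableT_comp mg mY)).
have [C HC] := bg B; exists C; split; first exact: num_real.
by move=> M CM t Dt; rewrite /= (le_trans (HC _ (YB Dt))) // ltW.
Qed.

Lemma posint_param : posint (fun g => \int[mu]_(t in D) g (vec_of_tuple (Y t))).
Proof.
split=> [c f g nf ng|f f0]; last by apply: Rintegral_ge0 => t _.
have i1 := admissible_integrable nf; have i2 := admissible_integrable ng.
rewrite RintegralD //; first by rewrite RintegralZl.
have := admissible_integrable (admissibleM (admissible_cst c) nf); exact.
Qed.

End Param.

Lemma posint_scale c J : 0 <= c -> posint J -> posint (fun g => c * J g).
Proof.
move=> c0 [J1 J2]; split=> [a f g nf ng|f f0]; last by rewrite mulr_ge0 // J2.
by rewrite J1 //; ring.
Qed.

End PosInt.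

Section MeshIntegrals.
Context {R : realType} {n : nat} (M : mesh R n).
Local Notation RT := (measurableTypeR R).
Local Notation simplex := {set 'I_(nnodes M)}.

Lemma measurable_ref_simplex d : measurable (@ref_simplex R d).
Proof.
apply: measurableI.
  apply: (@measurable_forall _ _ _ (fun i t => (0 <= (tnth t i : R))%R)) => i.
  rewrite (_ : (fun _ => _) = (fun t => tnth t i) @^-1` `[0%R, +oo[).
    by rewrite -[X in measurable X]setTI; apply: (@measurable_tnth _ RT d i measurableT).
  by apply/seteqP; split => t /=; rewrite in_itv /= andbT.
rewrite (_ : (fun _ => _) = (fun t : d.-tuple RT => \sum_i (tnth t i : R)) @^-1` `]-oo, 1%R]).
  rewrite -[X in measurable X]setTI.
  have : measurable_fun [set: d.-tuple RT] (fun t : d.-tuple RT => \sum_i (tnth t i : R)).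
    by apply: measurable_sum => i; exact: measurable_tnth.
  by apply.
by apply/seteqP; split => t /=; rewrite in_itv.
Qed.

Lemma tbox_lty d (A : set (d.-tuple RT)) (B : R) : measurable A -> 0 <= B ->
  (forall t, A t -> forall i, `|tnth t i : R| <= B) -> (lebesgue_tuple d A < +oo)%E.
Proof.
move=> mA B0 AB; have := @lebesgue_tuple_box R d (fun=> - B) (fun=> B).
move=> /(_ _) E; apply: (@le_lt_trans _ _ (lebesgue_tuple d (tbox (fun=> - B) (fun=> B)))).
  apply: le_measure; rewrite ?inE //; first exact: measurable_tbox.
  by move=> t At i; rewrite -ler_norml; exact: AB.
by rewrite E ?ltry // => i; rewrite lerNl (le_trans _ B0) // oppr_le0.
Qed.

(** The parametrization of a face, as a map between the tuple types that carry
    the Lebesgue measures. *)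
Definition face_pt (e : simplex) (t : n.-1.-tuple RT) : n.-tuple RT :=
  [tuple (face_param e t 0 i : RT) | i < n].

Lemma face_ptE (e : simplex) t : vec_of_tuple (face_pt e t) = face_param e t.
Proof. by apply/rowP => i; rewrite mxE tnth_mktuple. Qed.

Lemma face_param_coord (e : simplex) (t : n.-1.-tuple RT) i : face_param e t 0 i =
  vertex e 0 0 i + \sum_a (tnth t a : R) * face_edges e a i.
Proof.
by rewrite /face_param !mxE; congr (_ + _); apply: eq_bigr => a _; rewrite !mxE.
Qed.

Lemma posint_int_face (e : simplex) : posint (@int_face R n M e).
Proof.
apply: posint_scale; first exact: sqrtr_ge0.
rewrite (_ : (fun g => _) = fun g => \int[lebesgue_tuple n.-1]_(t in @ref_simplex R n.-1)
    g (vec_of_tuple (face_pt e t))); last first.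
  by apply/funext => g; under [in RHS]eq_Rintegral do rewrite face_ptE.
have D1 (t : n.-1.-tuple RT) : ref_simplex t -> forall i, `|tnth t i : R| <= 1.
  move=> [t0 t1] i; rewrite ger0_norm //; apply: le_trans t1.
  by rewrite (bigD1 i) //= lerDl sumr_ge0.
pose B := \sum_i (`|vertex e 0 0 i| + \sum_a `|face_edges e a i|).
apply: (@posint_param _ _ _ _ _ _ _ B).
- exact: measurable_ref_simplex.
- exact: (@tbox_lty n.-1 _ 1 (@measurable_ref_simplex n.-1) ler01 D1).
- apply/measurable_fun_tnthP => i.
  rewrite (_ : _ \o _ = fun t => vertex e 0 0 i +
      \sum_a (tnth t a : R) * face_edges e a i); last first.
    by apply/funext => t; rewrite /= tnth_mktuple face_param_coord.
  apply: measurable_funD; first exact: measurable_cst.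
  apply: measurable_sum => a; apply: measurable_funM; last exact: measurable_cst.
  exact: measurable_tnth.
- move=> t /D1 t1 i; rewrite face_ptE face_param_coord /B (bigD1 i) //=.
  rewrite -[leLHS]addr0 lerD ?sumr_ge0 //; last by move=> j _; rewrite addr_ge0 ?sumr_ge0.
  rewrite (le_trans (ler_normD _ _)) // lerD // (le_trans (ler_norm_sum _ _ _)) //.
  apply: ler_sum => a _; rewrite normrM ler_piMl //.
Qed.

End MeshIntegrals.

(** * Integration over a nondegenerate cell *)

Section Cells.
Context {R : realType} {n : nat} (M : mesh R n).
Local Notation RT := (measurableTypeR R).
Local Notation simplex := {set 'I_(nnodes M)}.

Definition nondeg (K : simplex) := #|K| = n.+1 /\ aff_indep (node M) K.

Definition cell_region (K : simplex) : set (n.-tuple RT) :=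
  @vec_of_tuple R n @^-1` geom K.

Variable K : simplex.
Hypothesis ndK : nondeg K.

Lemma measurable_cell_region : measurable (cell_region K).
Proof.
have [sn sP] := ndK; rewrite /cell_region /geom (hullE sn sP).
apply: (@measurable_forall _ _ _
  (fun a t => (0 <= bary (node M) sn (vec_of_tuple t) 0 a)%R)) => a.
have [c [w cw]] := bary_affine (node M) sn a.
rewrite (_ : (fun _ => _) =
    (fun t : n.-tuple RT => c + \sum_i (tnth t i : R) * w i) @^-1` `[0%R, +oo[).
  rewrite -[X in measurable X]setTI.
  have : measurable_fun [set: n.-tuple RT]
      (fun t : n.-tuple RT => c + \sum_i (tnth t i : R) * w i).
    apply: measurable_funD; first exact: measurable_cst.
    apply: measurable_sum => i; apply: measurable_funM; last exact: measurable_cst.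
    exact: measurable_tnth.
  by apply.
have E t : \sum_i @vec_of_tuple R n t 0 i * w i = \sum_i (tnth t i : R) * w i.
  by apply: eq_bigr => i _; rewrite mxE.
apply/seteqP; split => t /=; rewrite in_itv /= andbT cw.
  by rewrite E.
by rewrite E.
Qed.

Lemma cell_region_lty : (lebesgue_tuple n (cell_region K) < +oo)%E.
Proof.
have [B KB] := hull_bounded (node M) K.
apply: (@tbox_lty _ n _ `|B| measurable_cell_region) => // t /KB tB i.
by have := tB i; rewrite mxE => /le_trans; apply; exact: ler_norm.
Qed.

Lemma posint_int_cell : posint (@int_cell R n M K).
Proof.
have [B KB] := hull_bounded (node M) K.
apply: (@posint_param R n _ _ (lebesgue_tuple n) (cell_region K) id B).
- exact: measurable_cell_region.
- exact: cell_region_lty.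
- exact: measurable_id.
- by move=> t /KB.
Qed.

Lemma admissible_integrable_cell g : admissible g ->
  (lebesgue_tuple n).-integrable (cell_region K) (EFin \o (g \o @vec_of_tuple R n)).
Proof.
have [B KB] := hull_bounded (node M) K.
apply: (@admissible_integrable R n _ _ (lebesgue_tuple n) (cell_region K) id B).
- exact: measurable_cell_region.
- exact: cell_region_lty.
- exact: measurable_id.
- by move=> t /KB.
Qed.

(** On a set of finite measure an L2 function is integrable, since
    2 |a| <= 1 + a^2. *)
Lemma L2_mul_integrable (D : set 'rV[R]_n) f g :
  measurable (@vec_of_tuple R n @^-1` D : set (n.-tuple RT)) -> geom K `<=` D ->
  L2_on D f -> admissible g ->
  (lebesgue_tuple n).-integrable (cell_region K)
    (EFin \o (fun t => g (vec_of_tuple t) * f (vec_of_tuple t))).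
Proof.
move=> mD KD [mf f2] [mg bg].
have mfK : measurable_fun (cell_region K) (f \o @vec_of_tuple R n).
  by apply: (measurable_funS mD _ mf) => t; exact: KD.
have f2K : (lebesgue_tuple n).-integrable (cell_region K)
    (EFin \o (fun t => f (vec_of_tuple t) ^+ 2)).
  apply: (integrableS mD measurable_cell_region); first by move=> t; exact: KD.
  apply/integrableP; split.
    by apply/measurable_EFinP; exact: measurable_funX.
  apply: le_lt_trans f2; rewrite le_eqVlt; apply/orP; left; apply/eqP.
  by apply: eq_integral => t _; rewrite /= ger0_norm ?sqr_ge0.
have fK : (lebesgue_tuple n).-integrable (cell_region K) (EFin \o (f \o @vec_of_tuple R n)).
  have one := admissible_integrable_cell (admissible_cst 1).
  apply: (le_integrable measurable_cell_region _ _ (integrableD measurable_cell_region one f2K)).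
    exact/measurable_EFinP.
  move=> t _; rewrite /= lee_fin [leRHS]ger0_norm ?addr_ge0 ?sqr_ge0 //.
  set a := f _; have := sqr_ge0 (`|a| - 1); rewrite sqrrB1 real_normK ?num_real //.
  have := sqr_ge0 a; lra.
have [B KB] := hull_bounded (node M) K; have [C HC] := bg B.
have bgK : [bounded (g \o @vec_of_tuple R n) t | t in cell_region K].
  exists C; split; first exact: num_real.
  by move=> c Cc t /KB tB; rewrite /= (le_trans (HC _ tB)) // ltW.
have mgK : measurable_fun (cell_region K) (g \o @vec_of_tuple R n) by exact: measurable_funTS.
exact: (integrableMr measurable_cell_region mgK bgK fK).
Qed.

(** If p does not vanish at some point of the interior of the cell, then p^2 is
    bounded below on a small box, which has positive measure. *)
Lemma cell_definite p :
  int_cell K (fun x => pev p x * pev p x) = 0 -> p = 0.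
Proof.
move=> p0; have [sn sP] := ndK; have [x0 [d [d0 Hd]]] := hull_box sn sP.
apply: (mpoly_box0 d0) => x xd; apply/eqP/negP => /negP px.
pose eps := pev p x * pev p x / 2.
have eps0 : 0 < eps by rewrite divr_gt0 // -expr2 exprn_even_gt0.
have cp2 : continuous (fun y => pev p y * pev p y).
  by move=> y; apply: continuousM; exact: pev_continuous.
have near1 : nbhs x [set y | eps < pev p y * pev p y].
  have eps_lt : eps < pev p x * pev p x.
    by rewrite /eps ltr_pdivrMr // ltr_pMr ?ltr1n // -expr2 exprn_even_gt0.
  exact: (cp2 x _ (lt_nbhsr eps_lt)).
have near2 : nbhs x (ball x0 d).
  apply: open_nbhs_nbhs; split; first exact: ball_open.
  by split => // a j; rewrite ord1 /ball /= distrC; exact: xd.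
have /nbhs_ballP[e /= e0 He] :
    nbhs x ([set y | eps < pev p y * pev p y] `&` ball x0 d).
  exact: filterI.
pose a i := x 0 i - e / 2; pose b i := x 0 i + e / 2.
have inb t : tbox a b t -> eps < pev p (vec_of_tuple t) * pev p (vec_of_tuple t)
    /\ geom K (vec_of_tuple t).
  move=> tab; have [] := He (vec_of_tuple t).
    split => // i j; rewrite ord1 mxE /ball /= distrC ltr_distl.
    by have /andP[] := tab j; rewrite /a /b => ? ?; apply/andP; split; lra.
  move=> h1 [_ h2]; split => //; apply: Hd => i; apply: ltW.
  by have := h2 0 i; rewrite /ball /= distrC.
have box_pos : (0 < eps%:E * lebesgue_tuple n (tbox a b))%E.
  rewrite lebesgue_tuple_box => [|i]; last by rewrite /a /b; lra.
  rewrite -EFinM lte_fin mulr_gt0 // prodr_gt0 // => i _; rewrite /a /b; lra.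
have mp2 : measurable_fun [set: n.-tuple RT]
    (EFin \o (fun t => pev p (vec_of_tuple t) * pev p (vec_of_tuple t))).
  by apply/measurable_EFinP; have [] := admissibleM (admissible_pev p) (admissible_pev p).
have int0 : (\int[lebesgue_tuple n]_(t in cell_region K)
    (pev p (vec_of_tuple t) * pev p (vec_of_tuple t))%:E = 0)%E.
  rewrite -[LHS]fineK; last first.
    apply: integrable_fin_num; first exact: measurable_cell_region.
    exact: (admissible_integrable_cell (admissibleM (admissible_pev p) (admissible_pev p))).
  by rewrite -[X in _ = X%:E]p0.
move: box_pos; rewrite ltNge => /negP; apply; rewrite -int0.
rewrite -(integral_cst _ (measurable_tbox a b)).
apply: (@le_trans _ _ (\int[lebesgue_tuple n]_(t in tbox a b)
    (pev p (vec_of_tuple t) * pev p (vec_of_tuple t))%:E)%E).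
  apply: ge0_le_integral.
  - exact: measurable_tbox.
  - by move=> t _; rewrite lee_fin ltW.
  - exact: measurable_cst.
  - exact: measurable_funTS mp2.
  - by move=> t /inb[h _]; rewrite lee_fin ltW.
apply: ge0_subset_integral.
- exact: measurable_tbox.
- exact: measurable_cell_region.
- exact: measurable_funTS mp2.
- by move=> t _; rewrite lee_fin -expr2 sqr_ge0.
- by move=> t /inb[].
Qed.

Lemma hK_gt0 : (0 < n)%N -> 0 < hK K.
Proof.
move=> n0; have [sn sP] := ndK; have [x0 [d [d0 Hd]]] := hull_box sn sP.
pose i0 := Ordinal n0; pose y := x0 + d *: delta_mx 0 i0 : 'rV[R]_n.
have Kx0 : geom K x0 by apply: Hd => i; rewrite subrr normr0 ltW.
have Ky : geom K y.
  apply: Hd => i; rewrite !mxE addrAC subrr add0r /= normrM (gtr0_norm d0).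
  by rewrite ler_piMr ?(ltW d0) //; case: (i == i0); rewrite ?normr1 ?normr0.
have [B KB] := hull_bounded (node M) K.
have E0 : 0 < enorm (y - x0).
  rewrite /enorm sqrtr_gt0 /dotv (bigD1 i0) //= ltr_pwDl //.
    by rewrite !mxE !eqxx mulr1 addrAC subrr add0r mulr_gt0.
  by rewrite sumr_ge0 // => i _; rewrite -expr2 sqr_ge0.
apply: (lt_le_trans E0); apply: ub_le_sup; last by exists y, x0.
exists (Num.sqrt (\sum_(i < n) (B + B) * (B + B))) => _ [u [v [Ku Kv ->]]].
apply: ler_wsqrtr; apply: ler_sum => i _; rewrite -!expr2.
rewrite -(real_normK (num_real _)) ler_sqr ?nnegrE //; last first.
  by rewrite (le_trans _ (lerD (KB _ Ku i) (KB _ Ku i))) // addr_ge0.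
by rewrite !mxE (le_trans (ler_normB _ _)) // lerD ?(KB _ Ku) ?(KB _ Kv).
Qed.

End Cells.

(** * Riesz representation and the weak operators *)

Definition ncoef (n g : nat) := #|{: bmultinom n g.+1}|.

Section PolyCoord.
Context {R : realType} {n : nat}.
Implicit Types (p q : mpoly n R).

Lemma deg_leD g p q : deg_le g p -> deg_le g q -> deg_le g (p + q).
Proof. by move=> hp hq; apply: leq_trans (msizeD_le _ _) _; rewrite geq_max hp hq. Qed.

Lemma deg_leZ g c p : deg_le g p -> deg_le g (c *: p).
Proof. by move=> hp; apply: leq_trans (msizeZ_le _ _) _. Qed.

Lemma deg_le0 g : deg_le g (0 : mpoly n R).
Proof. by rewrite /deg_le msize0. Qed.

Lemma deg_le_sum g (I : finType) (F : I -> mpoly n R) :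
  (forall i, deg_le g (F i)) -> deg_le g (\sum_i F i).
Proof.
by move=> dF; apply: (big_ind (deg_le g)) => //; [exact: deg_le0|exact: deg_leD].
Qed.



Definition poly_of g (c : 'I_(ncoef n g) -> R) : mpoly n R :=
  \sum_j c j *: mpolyX R (bmnm (enum_val j)).

Lemma poly_of_lin g a c d :
  @poly_of g (fun j => a * c j + d j) = a *: poly_of c + poly_of d.
Proof.
rewrite /poly_of scaler_sumr -big_split /=; apply: eq_bigr => j _.
by rewrite scalerDl scalerA.
Qed.

Lemma poly_of_deg g c : deg_le g (@poly_of g c).
Proof.
apply: deg_le_sum => j; apply: deg_leZ; rewrite /deg_le msizeX.
exact: bmdeg.
Qed.

Lemma poly_of_coef g p : deg_le g p ->
  poly_of (fun j : 'I_(ncoef n g) => mcoeff (bmnm (enum_val j)) p) = p.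
Proof.
move=> dp; rewrite [RHS](mpolywE dp) /poly_of.
rewrite [RHS](reindex (fun j : 'I_(ncoef n g) => enum_val j)) //.
by exists enum_rank => j _; rewrite ?enum_valK ?enum_rankK.
Qed.

End PolyCoord.

Section Riesz.
Context {R : realType} {n : nat} (M : mesh R n).
Local Notation simplex := {set 'I_(nnodes M)}.
Variables (K : simplex) (ndK : nondeg K).

Let Jp := posint_int_cell ndK.

(** Expand the representative in an orthonormal basis of the L2 product on the
    polynomials of degree at most g, which is definite by cell_definite. *)
Lemma riesz g (L : mpoly n R -> R) : scalar L ->
  exists2 D, deg_le g D & forall s, deg_le g s ->
    int_cell K (fun x => pev D x * pev s x) = L s.
Proof.
move=> Ll; pose P (x : 'rV[R]_(ncoef n g)) := poly_of (fun j => x 0 j) : mpoly n R.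
have Plin a x y : P (a *: x + y) = a *: P x + P y.
  by rewrite /P -poly_of_lin; congr poly_of; apply/funext => j; rewrite !mxE.
have P0 : P 0 = 0.
  by rewrite /P /poly_of big1 // => j _; rewrite mxE scale0r.
have Psum k (c : 'I_k -> R) e : P (\sum_i c i *: e i) = \sum_i c i *: P (e i).
  by elim/big_rec2: _ => // i u v _ <-; rewrite Plin.
pose s x y := int_cell K (fun z => pev (P x) z * pev (P y) z).
have sl y : scalar (s ^~ y).
  move=> a x z; rewrite /s -(Jp.1 a); last 2 first.
  - exact: (admissibleM (admissible_pev _) (admissible_pev _)).
  - exact: (admissibleM (admissible_pev _) (admissible_pev _)).
  by congr int_cell; apply/funext => t; rewrite Plin pevD pevZ; ring.
have sP : psd_form s.
  split=> [x y|y|x]; [|exact: sl|].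
    by apply: (congr1 (@int_cell R n M K)); apply/funext => t; exact: mulrC.
  by apply: Jp.2 => t; rewrite -expr2 sqr_ge0.
have tP : subspace (fun _ : 'rV[R]_(ncoef n g) => True) by split.
have [k [e [_ eo eb]]] := orthonormal_basis sP tP.
exists (\sum_i L (P (e i)) *: P (e i)).
  by apply: deg_le_sum => i; apply: deg_leZ; exact: poly_of_deg.
move=> q dq; pose y : 'rV[R]_(ncoef n g) := \row_j mcoeff (bmnm (enum_val j)) q.
have yq : P y = q.
  by rewrite -[RHS](poly_of_coef dq); congr poly_of; apply/funext => j; rewrite mxE.
have := eb y I; set w := y - _ => /= ww.
have Pw : P w = 0 by apply: (cell_definite ndK).
have yE : y = 1 *: (\sum_i s y (e i) *: e i) + w by rewrite scale1r addrC subrK.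
rewrite -yq -Psum -/(s _ y) (scalar_sum _ _ (sl y)).
have -> : L (P y) = \sum_i s y (e i) * L (P (e i)).
  by rewrite [in LHS]yE Plin Pw addr0 scale1r Psum (scalar_sum _ _ Ll).
by case: sP => sC _ _; apply: eq_bigr => i _; rewrite mulrC (sC (e i)).
Qed.

Variable g : nat.

Lemma scalar_face (e : simplex) (h : 'rV[R]_n -> R) : admissible h ->
  scalar (fun t : mpoly n R => int_face e (fun x => h x * pev t x)).
Proof.
move=> nh a t u; rewrite -((posint_int_face e).1 a); last 2 first.
- exact: (admissibleM nh (admissible_pev _)).
- exact: (admissibleM nh (admissible_pev _)).
by congr int_face; apply/funext => x; rewrite pevD pevZ; ring.
Qed.

Lemma scalar_cell_deriv (h : 'rV[R]_n -> R) i : admissible h ->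
  scalar (fun t : mpoly n R => int_cell K (fun x => h x * pev (mderiv i t) x)).
Proof.
move=> nh a t u; rewrite -(Jp.1 a); last 2 first.
- exact: (admissibleM nh (admissible_pev _)).
- exact: (admissibleM nh (admissible_pev _)).
by congr int_cell; apply/funext => x; rewrite mderivD mderivZ pevD pevZ; ring.
Qed.

(** The defining identity splits into one Riesz problem per component. *)
Lemma weak_gradP vi (vb : simplex -> 'rV[R]_n -> R) :
  admissible vi -> (forall e, admissible (vb e)) ->
  is_weak_grad g K vi vb (weak_grad g K vi vb).
Proof.
move=> nvi nvb; apply: xgetPex.
pose L i (t : mpoly n R) := -1 * int_cell K (fun x => vi x * pev (mderiv i t) x) +
  \sum_(e | facet K e) int_face e (fun x => (vb e x * normal K e 0 i) * pev t x).
have Ll i : scalar (L i).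
  apply: scalarDl; first exact: scalar_cell_deriv.
  apply: scalar_sumf => e; apply: scalar_face.
  exact: (admissibleM (nvb e) (admissible_cst _)).
have /choice[D HD] i : exists D, deg_le g D /\ forall s, deg_le g s ->
    int_cell K (fun x => pev D x * pev s x) = L i s.
  by have [D] := riesz g (Ll i); exists D.
exists (\row_i D i); split => [i|s ds]; first by rewrite mxE; exact: (HD i).1.
transitivity (\sum_i L i (s 0 i)).
  rewrite -[RHS](eq_bigr _ (fun i _ => (HD i).2 _ (ds i))).
  rewrite -(posint_sum Jp) => [|i]; last exact: (admissibleM (admissible_pev _) (admissible_pev _)).
  by congr int_cell; apply/funext => x; apply: eq_bigr => i _; rewrite !mxE.
rewrite big_split /= -mulr_sumr mulN1r; congr (- _ + _).
  rewrite -(posint_sum Jp) => [|i]; last exact: (admissibleM nvi (admissible_pev _)).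
  by congr int_cell; apply/funext => x; rewrite /Defs.pdiv pev_sum mulr_sumr.
rewrite exchange_big /=; apply: eq_bigr => e _.
rewrite -(posint_sum (posint_int_face e)) => [|i]; last first.
  exact: (admissibleM (admissibleM (nvb e) (admissible_cst _)) (admissible_pev _)).
congr int_face; apply/funext => x; rewrite /dotv mulr_sumr.
by apply: eq_bigr => i _; rewrite !mxE; ring.
Qed.

Lemma weak_divP (wi : 'rV[R]_n -> 'rV[R]_n) (wb : simplex -> 'rV[R]_n -> 'rV[R]_n) :
  (forall i, admissible (fun x => wi x 0 i)) -> (forall e i, admissible (fun x => wb e x 0 i)) ->
  is_weak_div g K wi wb (weak_div g K wi wb).
Proof.
move=> nwi nwb; apply: xgetPex.
pose L (t : mpoly n R) :=
  -1 * (\sum_i int_cell K (fun x => wi x 0 i * pev (mderiv i t) x)) +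
  \sum_(e | facet K e) int_face e (fun x => dotv (wb e x) (normal K e) * pev t x).
have Ll : scalar L.
  apply: scalarDl; first by apply: scalar_sumf => i; exact: scalar_cell_deriv.
  apply: scalar_sumf => e; apply: scalar_face; apply: admissible_dotv => // i.
  exact: admissible_cst.
have [D dD HD] := riesz g Ll; exists D; split => // s ds.
rewrite HD // /L mulN1r; congr (- _ + _).
rewrite -(posint_sum Jp) => [|i]; last exact: (admissibleM (nwi i) (admissible_pev _)).
by congr int_cell; apply/funext => x; apply: eq_bigr => i _; rewrite !mxE.
Qed.

End Riesz.

(** * Multilinearity and positivity of the discrete forms *)

Section Forms.
Context {R : realType} {n : nat} (M : mesh R n).
Local Notation simplex := {set 'I_(nnodes M)}.
Local Notation velocity := (@velocity R n M).
Local Notation pressure := (@pressure R n M).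
Implicit Types (u v w k : velocity) (p q : pressure).
Hypothesis ndM : forall K, K \in cells M -> nondeg K.

(** The linear combination c u + v; velocities form no module, as their
    components are modules over polynomials instead of scalars. *)
Definition vlin c (u v : velocity) : velocity := Velocity
  (fun K => \row_i (c *: vin u K 0 i + vin v K 0 i))
  (fun e => \row_i (c *: vbd u e 0 i + vbd v e 0 i)).

Definition plin c (p q : pressure) : pressure := Pressure
  (fun K => c *: pin p K + pin q K) (fun e => c *: pbd p e + pbd q e).

Definition vscalar (h : velocity -> R) :=
  forall c u v, h (vlin c u v) = c * h u + h v.

Lemma pev_vin_lin c (u v : velocity) K i x :
  pev (vin (vlin c u v) K 0 i) x = c * pev (vin u K 0 i) x + pev (vin v K 0 i) x.
Proof. by rewrite mxE pevD pevZ. Qed.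

Lemma pev_vbd_lin c (u v : velocity) K i x :
  pev (vbd (vlin c u v) K 0 i) x = c * pev (vbd u K 0 i) x + pev (vbd v K 0 i) x.
Proof. by rewrite mxE pevD pevZ. Qed.

Lemma vscalar_sum (I : finType) (P : pred I) (F : I -> velocity -> R) :
  (forall i, P i -> vscalar (F i)) -> vscalar (fun v => \sum_(i | P i) F i v).
Proof.
move=> Fl c u v; rewrite mulr_sumr -big_split /=.
by apply: eq_bigr => i Pi; exact: Fl.
Qed.

Lemma vscalarD h1 h2 : vscalar h1 -> vscalar h2 -> vscalar (fun v => h1 v + h2 v).
Proof. by move=> l1 l2 c u v; rewrite l1 l2; ring. Qed.

Lemma vscalarB h1 h2 : vscalar h1 -> vscalar h2 -> vscalar (fun v => h1 v - h2 v).
Proof. by move=> l1 l2 c u v; rewrite l1 l2; ring. Qed.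

Lemma vscalarZ a h : vscalar h -> vscalar (fun v => a * h v).
Proof. by move=> l c u v; rewrite l; ring. Qed.

Lemma vscalarN h : vscalar h -> vscalar (fun v => - h v).
Proof. by move=> l c u v; rewrite l; ring. Qed.

Lemma vscalar_posint J (F : velocity -> 'rV[R]_n -> R) : posint J ->
  (forall v, admissible (F v)) ->
  (forall c u v x, F (vlin c u v) x = c * F u x + F v x) ->
  vscalar (fun v => J (F v)).
Proof.
move=> Jp nF Fl c u v; rewrite -(Jp.1 c _ _ (nF u) (nF v)).
by congr J; apply/funext => x; exact: Fl.
Qed.

Lemma admissible_vpev (p : 'rV[mpoly n R]_n) i : admissible (fun x => vpev p x 0 i).
Proof.
rewrite (_ : (fun x => _) = pev (p 0 i)); first exact: admissible_pev.
by apply/funext => x; rewrite mxE.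
Qed.

Lemma vpevB (p q : 'rV[mpoly n R]_n) x i :
  (vpev p x - vpev q x) 0 i = pev (p 0 i) x - pev (q 0 i) x.
Proof. by rewrite !mxE. Qed.

Lemma vscalar_l2 (w : simplex -> 'rV[R]_n -> 'rV[R]_n) :
  (forall K i, K \in cells M -> admissible (fun x => w K x 0 i)) ->
  vscalar (fun v => l2_inner w (fun K => vpev (vin v K))).
Proof.
move=> nw; apply: vscalar_sum => K Kc.
apply: (vscalar_posint (posint_int_cell (ndM Kc))) => [v|c u v x].
  by apply: admissible_dotv => i; [exact: nw|exact: admissible_vpev].
rewrite /dotv mulr_sumr -big_split /=; apply: eq_bigr => i _.
by rewrite ![vpev _ _ _ _]mxE pev_vin_lin; ring.
Qed.

Lemma l2C (w z : simplex -> 'rV[R]_n -> 'rV[R]_n) : l2_inner w z = l2_inner z w.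
Proof.
apply: eq_bigr => K _; congr int_cell; apply/funext => x.
by apply: eq_bigr => i _; rewrite mulrC.
Qed.

Lemma l2_ge0 (u : velocity) :
  0 <= l2_inner (fun K => vpev (vin u K)) (fun K => vpev (vin u K)).
Proof.
rewrite sumr_ge0 // => K Kc; apply: (posint_int_cell (ndM Kc)).2 => x.
by rewrite sumr_ge0 // => i _; rewrite -expr2 sqr_ge0.
Qed.

Section Diffusion.
Variables (nu : R) (l : nat).

Lemma vgradP (v : velocity) K i : K \in cells M ->
  is_weak_grad l K (pev (vin v K 0 i)) (fun e => pev (vbd v e 0 i)) (vgrad l v K i).
Proof.
by move=> Kc; apply: (weak_gradP (ndM Kc)) => *; exact: admissible_pev.
Qed.

Definition jump_form (u v : velocity) := \sum_(K in cells M) \sum_(e | facet K e)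
  int_face e (fun x => (hK K)^-1 * dotv (vpev (vin u K) x - vpev (vbd u e) x)
                           (vpev (vin v K) x - vpev (vbd v e) x)).

Definition grad_form (u v : velocity) := \sum_(K in cells M) \sum_i
  int_cell K (fun x => dotv (vpev (vgrad l u K i) x) (vpev (vgrad l v K i) x)).

Lemma form_aE u v : form_a nu l u v = nu * grad_form u v + nu * jump_form u v.
Proof. by []. Qed.

Lemma dotvC (x y : 'rV[R]_n) : dotv x y = dotv y x.
Proof. by apply: eq_bigr => i _; rewrite mulrC. Qed.

Lemma grad_formC u v : grad_form u v = grad_form v u.
Proof.
apply: eq_bigr => K _; apply: eq_bigr => i _.
by apply: (congr1 (@int_cell R n M K)); apply/funext => x; exact: dotvC.
Qed.

Lemma jump_formC u v : jump_form u v = jump_form v u.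
Proof.
apply: eq_bigr => K _; apply: eq_bigr => e _.
apply: (congr1 (@int_face R n M e)); apply/funext => x.
exact: (congr1 ( *%R _) (dotvC _ _)).
Qed.

Lemma form_aC u v : form_a nu l u v = form_a nu l v u.
Proof. by rewrite !form_aE grad_formC jump_formC. Qed.

(** The gradient term is linear in u through the defining identity of the weak
    gradient of u, tested with the weak gradient of v. *)
Lemma vscalar_form_a v : vscalar (fun u => form_a nu l u v).
Proof.
apply: (@vscalarD (fun u => nu * grad_form u v) (fun u => nu * jump_form u v));
  apply: vscalarZ; apply: vscalar_sum => K Kc; last first.
  apply: vscalar_sum => e _.
  apply: (vscalar_posint (posint_int_face e)) => [u|c u u' x].
    apply: (admissibleM (admissible_cst _)); apply: admissible_dotv => i.
      rewrite (_ : (fun x => _) = fun x => pev (vin u K 0 i) x +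
          (-1) * pev (vbd u e 0 i) x); last first.
        by apply/funext => x; rewrite !mxE mulN1r.
      exact: (admissibleD (admissible_pev _) (admissibleM (admissible_cst _) (admissible_pev _))).
    rewrite (_ : (fun x => _) = fun x => pev (vin v K 0 i) x +
        (-1) * pev (vbd v e 0 i) x); last first.
      by apply/funext => x; rewrite !mxE mulN1r.
    exact: (admissibleD (admissible_pev _) (admissibleM (admissible_cst _) (admissible_pev _))).
  rewrite mulrCA -mulrDr; congr (_ * _).
  rewrite /dotv mulr_sumr -big_split /=; apply: eq_bigr => i _.
  by rewrite !vpevB pev_vin_lin pev_vbd_lin; ring.
apply: vscalar_sum => i _ c u u'.
have [dv _] := vgradP v i Kc.
pose L w := - int_cell K (fun x => pev (vin w K 0 i) x * pev (Defs.pdiv (vgrad l v K i)) x)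
  + \sum_(e | facet K e) int_face e (fun x => pev (vbd w e 0 i) x *
      dotv (vpev (vgrad l v K i) x) (normal K e)).
have LE w : int_cell K (fun x =>
    dotv (vpev (vgrad l w K i) x) (vpev (vgrad l v K i) x)) = L w.
  exact: (vgradP w i Kc).2 _ dv.
have Ll : vscalar L.
  apply: vscalarD.
    apply: vscalarN; apply: (vscalar_posint (posint_int_cell (ndM Kc))) => [w|a w w' x].
      exact: (admissibleM (admissible_pev _) (admissible_pev _)).
    by rewrite pev_vin_lin; ring.
  apply: vscalar_sum => e _.
  apply: (vscalar_posint (posint_int_face e)) => [w|a w w' x].
    apply: (admissibleM (admissible_pev _)); apply: admissible_dotv => j; last exact: admissible_cst.
    exact: admissible_vpev.
  by rewrite pev_vbd_lin; ring.
apply: etrans (LE (vlin c u u')) _.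
by apply: etrans (Ll c u u') _; rewrite -(LE u) -(LE u').
Qed.

Lemma dotv_ge0 (x : 'rV[R]_n) : 0 <= dotv x x.
Proof. by rewrite sumr_ge0 // => i _; rewrite -expr2 sqr_ge0. Qed.

Lemma grad_form_ge0 u : 0 <= grad_form u u.
Proof.
rewrite sumr_ge0 // => K Kc; rewrite sumr_ge0 // => i _.
by apply: (posint_int_cell (ndM Kc)).2 => x; exact: dotv_ge0.
Qed.

Hypothesis n0 : (0 < n)%N.

Lemma jump_term_ge0 u K e : K \in cells M -> 0 <= int_face e
  (fun x => (hK K)^-1 * dotv (vpev (vin u K) x - vpev (vbd u e) x)
                           (vpev (vin u K) x - vpev (vbd u e) x)).
Proof.
move=> Kc; apply: (posint_int_face e).2 => x.
by rewrite mulr_ge0 ?dotv_ge0 // invr_ge0 ltW // (hK_gt0 (ndM Kc)).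
Qed.

Lemma jump_form_ge0 u : 0 <= jump_form u u.
Proof.
rewrite sumr_ge0 // => K Kc; rewrite sumr_ge0 // => e _; exact: jump_term_ge0.
Qed.

End Diffusion.
End Forms.

Section ConvectionReaction.
Context {R : realType} {n : nat} (M : mesh R n).
Local Notation simplex := {set 'I_(nnodes M)}.
Local Notation velocity := (@velocity R n M).
Local Notation pressure := (@pressure R n M).
Implicit Types (u v w k : velocity) (p q : pressure).
Hypothesis ndM : forall K, K \in cells M -> nondeg K.

Lemma vpevE (s : 'rV[mpoly n R]_n) x i : vpev s x 0 i = pev (s 0 i) x.
Proof. exact: mxE. Qed.

Definition cell_deg m v := forall K, K \in cells M -> vdeg_le m (vin v K).

Lemma vscalar_form_b m q : vscalar (fun v => form_b m v q).
Proof. by apply: (vscalar_l2 ndM) => K i _; exact: admissible_vpev. Qed.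

(** The weak gradient of q, tested with the polynomial v, is linear in q by its
    defining identity. *)
Lemma form_b_linr m v : cell_deg m v ->
  forall c p q, form_b m v (plin c p q) = c * form_b m v p + form_b m v q.
Proof.
move=> dv c p q; rewrite /form_b /l2_inner mulr_sumr -big_split /=.
apply: eq_bigr => K Kc; have ds := dv K Kc.
have wgP r : is_weak_grad m K (pev (pin r K)) (fun e => pev (pbd r e))
    (weak_grad m K (pev (pin r K)) (fun e => pev (pbd r e))).
  by apply: (weak_gradP (ndM Kc)) => *; exact: admissible_pev.
pose B r := - int_cell K (fun x => pev (pin r K) x * pev (Defs.pdiv (vin v K)) x) +
  \sum_(e | facet K e) int_face e (fun x => pev (pbd r e) x *
    dotv (vpev (vin v K) x) (normal K e)).
have BE r : int_cell K (fun x => dotv (vpev (weak_grad m K (pev (pin r K))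
    (fun e => pev (pbd r e))) x) (vpev (vin v K) x)) = B r.
  exact: (wgP r).2 _ ds.
apply: etrans (BE (plin c p q)) _.
apply: etrans _ (esym (congr2 +%R (congr1 ( *%R c) (BE p)) (BE q))).
rewrite /B /=.
have -> : int_cell K (fun x => pev (c *: pin p K + pin q K) x * pev (Defs.pdiv (vin v K)) x)
    = c * int_cell K (fun x => pev (pin p K) x * pev (Defs.pdiv (vin v K)) x)
      + int_cell K (fun x => pev (pin q K) x * pev (Defs.pdiv (vin v K)) x).
  rewrite -((posint_int_cell (ndM Kc)).1 c); last 2 first.
  - exact: (admissibleM (admissible_pev _) (admissible_pev _)).
  - exact: (admissibleM (admissible_pev _) (admissible_pev _)).
  by congr (int_cell K _); apply/funext => x; rewrite pevD pevZ; ring.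
have face e : int_face e (fun x => pev (c *: pbd p e + pbd q e) x *
    dotv (vpev (vin v K) x) (normal K e)) =
    c * int_face e (fun x => pev (pbd p e) x * dotv (vpev (vin v K) x) (normal K e))
    + int_face e (fun x => pev (pbd q e) x * dotv (vpev (vin v K) x) (normal K e)).
  have nd : admissible (fun x => dotv (vpev (vin v K) x) (normal K e)).
    by apply: admissible_dotv => i; [exact: admissible_vpev|exact: admissible_cst].
  rewrite -((posint_int_face e).1 c); last 2 first.
  - exact: (admissibleM (admissible_pev _) nd).
  - exact: (admissibleM (admissible_pev _) nd).
  by congr (int_face e _); apply/funext => x; rewrite pevD pevZ; ring.
rewrite (eq_bigr _ (fun e _ => face e)) big_split /= -mulr_sumr; ring.
Qed.

Section Reaction.
Variables (alpha r : R).
Hypothesis r2 : 0 <= r - 2.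

Lemma admissible_reaction u v K i :
  admissible (fun x => (enorm (vpev (vin u K) x) `^ (r - 2) *: vpev (vin v K) x) 0 i).
Proof.
rewrite (_ : (fun x => _) = fun x =>
    enorm (vpev (vin u K) x) `^ (r - 2) * vpev (vin v K) x 0 i); last first.
  by apply/funext => x; rewrite mxE.
apply: admissibleM; last exact: admissible_vpev.
by apply: admissible_powR_enorm => // j; exact: admissible_vpev.
Qed.

Lemma vscalar_form_c k u : vscalar (fun v => form_c alpha r k u v).
Proof.
apply: vscalarZ; apply: (vscalar_l2 ndM) => K i _; exact: admissible_reaction.
Qed.

Lemma form_c_ge0 k u : 0 <= alpha -> 0 <= form_c alpha r k u u.
Proof.
move=> a0; rewrite mulr_ge0 // sumr_ge0 // => K Kc.
apply: (posint_int_cell (ndM Kc)).2 => x; rewrite sumr_ge0 // => i _.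
by rewrite mxE -mulrA mulr_ge0 ?powR_ge0 // -expr2 sqr_ge0.
Qed.

End Reaction.

Section Convection.
Variable m : nat.

Lemma weak_tensor_divP u k K i : K \in cells M ->
  is_weak_div m K (fun y => pev (vin u K 0 i) y *: vpev (vin k K) y)
    (fun e y => pev (vbd u e 0 i) y *: vpev (vbd k e) y)
    (weak_div m K (fun y => pev (vin u K 0 i) y *: vpev (vin k K) y)
      (fun e y => pev (vbd u e 0 i) y *: vpev (vbd k e) y)).
Proof.
have ns (a : mpoly n R) (s : 'rV[mpoly n R]_n) j :
    admissible (fun x => (pev a x *: vpev s x) 0 j).
  rewrite (_ : (fun x => _) = fun x => pev a x * vpev s x 0 j); last first.
    by apply/funext => x; rewrite mxE.
  exact: (admissibleM (admissible_pev _) (admissible_vpev _ _)).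
by move=> Kc; apply: (weak_divP (ndM Kc)) => *; exact: ns.
Qed.

(** The contribution of the cell K and of the component i to the integral of
    the weak divergence of u (x) k against v. *)
Definition conv_cell u k v K i : R :=
  - int_cell K (fun x => pev (vin u K 0 i) x *
      dotv (vpev (vin k K) x) (vpev (pgrad (vin v K 0 i)) x)) +
  \sum_(e | facet K e) int_face e (fun x => pev (vbd u e 0 i) x *
      (dotv (vpev (vbd k e) x) (normal K e) * pev (vin v K 0 i) x)).

Lemma dotvZl (c : R) (x y : 'rV[R]_n) : dotv (c *: x) y = c * dotv x y.
Proof. by rewrite /dotv mulr_sumr; apply: eq_bigr => i _; rewrite mxE mulrA. Qed.

Lemma admissible_tensor_div u k K i : admissible (fun x => tensor_div m u k K x 0 i).
Proof.
rewrite (_ : (fun x => _) = pev (weak_div m K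
    (fun y => pev (vin u K 0 i) y *: vpev (vin k K) y)
    (fun e y => pev (vbd u e 0 i) y *: vpev (vbd k e) y))); first exact: admissible_pev.
by apply/funext => x; rewrite mxE.
Qed.

Lemma tensor_divE u k v : cell_deg m v ->
  l2_inner (tensor_div m u k) (fun K => vpev (vin v K)) =
  \sum_(K in cells M) \sum_i conv_cell u k v K i.
Proof.
move=> dv; apply: eq_bigr => K Kc.
transitivity (\sum_i int_cell K (fun x => tensor_div m u k K x 0 i * vpev (vin v K) x 0 i)).
  rewrite -(posint_sum (posint_int_cell (ndM Kc))) // => i.
  by apply: admissibleM; [exact: admissible_tensor_div|exact: admissible_vpev].
apply: eq_bigr => i _.
have := (weak_tensor_divP u k i Kc).2 _ (dv K Kc i).
set D := weak_div _ _ _ _ => DE.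
rewrite (_ : (fun x => _) = fun x => pev D x * pev (vin v K 0 i) x); last first.
  by apply/funext => x; rewrite !mxE.
rewrite DE /conv_cell; congr (- int_cell K _ + _).
  by apply/funext => x; rewrite dotvZl.
apply: eq_bigr => e _; congr (int_face e _).
by apply/funext => x; rewrite dotvZl mulrA.
Qed.

Lemma admissible_conv_in k v K i :
  admissible (fun x => dotv (vpev (vin k K) x) (vpev (pgrad (vin v K 0 i)) x)).
Proof. by apply: admissible_dotv => j; exact: admissible_vpev. Qed.

Lemma admissible_conv_bd k v K e i :
  admissible (fun x => dotv (vpev (vbd k e) x) (normal K e) * pev (vin v K 0 i) x).
Proof.
apply: admissibleM (admissible_pev _); apply: admissible_dotv => j; first exact: admissible_vpev.
exact: admissible_cst.
Qed.

Lemma vscalar_conv_cell k v K i : K \in cells M ->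
  vscalar (fun u => conv_cell u k v K i).
Proof.
move=> Kc; apply: vscalarD.
  apply: vscalarN; apply: (vscalar_posint (posint_int_cell (ndM Kc))) => [u|c u u' x].
    exact: (admissibleM (admissible_pev _) (admissible_conv_in _ _ _ _)).
  by rewrite pev_vin_lin; ring.
apply: vscalar_sum => e _.
apply: (vscalar_posint (posint_int_face e)) => [u|c u u' x].
  exact: (admissibleM (admissible_pev _) (admissible_conv_bd _ _ _ _ _)).
by rewrite pev_vbd_lin; ring.
Qed.

Lemma vscalar_conv_cell_adv u v K i : K \in cells M ->
  vscalar (fun k => conv_cell u k v K i).
Proof.
move=> Kc; apply: vscalarD.
  apply: vscalarN; apply: (vscalar_posint (posint_int_cell (ndM Kc))) => [k|c k k' x].
    exact: (admissibleM (admissible_pev _) (admissible_conv_in _ _ _ _)).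
  rewrite (_ : dotv (vpev (vin (vlin c k k') K) x) _ =
    c * dotv (vpev (vin k K) x) (vpev (pgrad (vin v K 0 i)) x) +
    dotv (vpev (vin k' K) x) (vpev (pgrad (vin v K 0 i)) x)); first by ring.
  rewrite /dotv mulr_sumr -big_split /=; apply: eq_bigr => j _.
  by rewrite !vpevE pev_vin_lin; ring.
apply: vscalar_sum => e _.
apply: (vscalar_posint (posint_int_face e)) => [k|c k k' x].
  exact: (admissibleM (admissible_pev _) (admissible_conv_bd _ _ _ _ _)).
rewrite (_ : dotv (vpev (vbd (vlin c k k') e) x) _ =
  c * dotv (vpev (vbd k e) x) (normal K e) + dotv (vpev (vbd k' e) x) (normal K e));
  first by ring.
rewrite /dotv mulr_sumr -big_split /=; apply: eq_bigr => j _.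
by rewrite !vpevE pev_vbd_lin; ring.
Qed.

Lemma vscalar_tensor_div k v : cell_deg m v ->
  vscalar (fun u => l2_inner (tensor_div m u k) (fun K => vpev (vin v K))).
Proof.
move=> dv c u u'.
apply: etrans (tensor_divE (vlin c u u') k dv) _.
apply: etrans _ (esym (congr2 +%R (congr1 ( *%R c) (tensor_divE u k dv))
  (tensor_divE u' k dv))).
by apply: (@vscalar_sum _ _ _ _ _ (fun K u => \sum_i conv_cell u k v K i)) => K Kc;
  apply: vscalar_sum => i _; exact: vscalar_conv_cell.
Qed.

Lemma vscalar_tensor_div_adv u v : cell_deg m v ->
  vscalar (fun k => l2_inner (tensor_div m u k) (fun K => vpev (vin v K))).
Proof.
move=> dv c k k'.
apply: etrans (tensor_divE u (vlin c k k') dv) _.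
apply: etrans _ (esym (congr2 +%R (congr1 ( *%R c) (tensor_divE u k dv))
  (tensor_divE u k' dv))).
by apply: (@vscalar_sum _ _ _ _ _ (fun K k => \sum_i conv_cell u k v K i)) => K Kc;
  apply: vscalar_sum => i _; exact: vscalar_conv_cell_adv.
Qed.

Lemma vscalar_l2_tensor k u :
  vscalar (fun v => l2_inner (tensor_div m u k) (fun K => vpev (vin v K))).
Proof. by apply: (vscalar_l2 ndM) => K i _; exact: admissible_tensor_div. Qed.

Lemma vscalar_form_d k u : cell_deg m u -> vscalar (fun v => form_d m k u v).
Proof.
move=> du; apply: vscalarB; apply: vscalarZ; first exact: vscalar_l2_tensor.
exact: vscalar_tensor_div.
Qed.

Lemma vscalar_form_d_tr k v : cell_deg m v -> vscalar (fun u => form_d m k u v).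
Proof.
move=> dv; apply: vscalarB; apply: vscalarZ; last exact: vscalar_l2_tensor.
exact: vscalar_tensor_div.
Qed.

Lemma vscalar_form_d_adv u v : cell_deg m u -> cell_deg m v ->
  vscalar (fun k => form_d m k u v).
Proof.
move=> du dv; apply: vscalarB; apply: vscalarZ; exact: vscalar_tensor_div_adv.
Qed.

Lemma form_d_diag k u : form_d m k u u = 0.
Proof. exact: subrr. Qed.

End Convection.

(** The kernel of the energy. A face polynomial in the kernel can be nonzero off
    its face, hence the condition on integrals instead of coefficients. *)
Definition vnull v := (forall K, K \in cells M -> vin v K = 0) /\
  forall K e i, K \in cells M -> facet K e ->
    int_face e (fun x => pev (vbd v e 0 i) x * pev (vbd v e 0 i) x) = 0.

Lemma vnull_energy (n0 : (0 < n)%N) (nu : R) l v : 0 < nu ->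
  l2_inner (fun K => vpev (vin v K)) (fun K => vpev (vin v K)) = 0 ->
  form_a nu l v v = 0 -> vnull v.
Proof.
move=> nu0 l20 a0.
have vin0 K : K \in cells M -> vin v K = 0.
  move=> Kc; have Jp := posint_int_cell (ndM Kc).
  have l2K : int_cell K (fun x => dotv (vpev (vin v K) x) (vpev (vin v K) x)) = 0.
    apply: (psumr_eq0P _ l20) Kc => L Lc; apply: (posint_int_cell (ndM Lc)).2 => x.
    exact: dotv_ge0.
  have {}l2K : \sum_i int_cell K (fun x => pev (vin v K 0 i) x * pev (vin v K 0 i) x) = 0.
    rewrite -(posint_sum Jp) => [|i]; last exact: (admissibleM (admissible_pev _) (admissible_pev _)).
    rewrite -[RHS]l2K; congr (int_cell K _); apply/funext => x.
    by apply: eq_bigr => i _; rewrite !mxE.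
  apply/rowP => i; rewrite mxE; apply: (cell_definite (ndM Kc)).
  apply: (psumr_eq0P _ l2K) => // j _; apply: Jp.2 => x.
  by rewrite -expr2 sqr_ge0.
split => // K e i Kc Ke; have Jp := posint_int_face e.
have j0 : jump_form v v = 0.
  have := a0; rewrite form_aE => /eqP; rewrite paddr_eq0.
  - by move=> /andP[_]; rewrite mulf_eq0 gt_eqF //= => /eqP.
  - by rewrite mulr_ge0 ?(ltW nu0) // (grad_form_ge0 ndM).
  - by rewrite mulr_ge0 ?(ltW nu0) // (jump_form_ge0 ndM).
have jK := psumr_eq0P (fun K Kc => sumr_ge0 _ (fun e _ => jump_term_ge0 ndM n0 v e Kc)) j0 Kc.
have {jK} := psumr_eq0P (fun e _ => jump_term_ge0 ndM n0 v e Kc) jK Ke.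
rewrite (_ : (fun x => _) = fun x => (hK K)^-1 *
    \sum_i pev (vbd v e 0 i) x * pev (vbd v e 0 i) x); last first.
  apply/funext => x; congr (_ * _); apply: eq_bigr => j _.
  by rewrite !vpevB vin0 // mxE pev0; ring.
have nb j : admissible (fun x => pev (vbd v e 0 j) x * pev (vbd v e 0 j) x).
  exact: (admissibleM (admissible_pev _) (admissible_pev _)).
rewrite (posintZ Jp) ?(posint_sum Jp) //; last exact: admissible_sum.
move=> /eqP; rewrite mulf_eq0 invr_eq0 gt_eqF ?(hK_gt0 (ndM Kc)) //= => /eqP s0.
apply: (psumr_eq0P _ s0) => // j _; apply: Jp.2 => x.
by rewrite -expr2 sqr_ge0.
Qed.

Lemma l2_null (w : simplex -> 'rV[R]_n -> 'rV[R]_n) v : vnull v -> l2_inner w (fun K => vpev (vin v K)) = 0.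
Proof.
move=> [v0 _]; rewrite /l2_inner big1 // => K Kc.
rewrite (_ : (fun x => _) = fun=> 0) ?(posint0 (posint_int_cell (ndM Kc))) //.
apply/funext => x; rewrite /dotv big1 // => i _.
by rewrite [vpev _ _ _ _]mxE v0 // mxE pev0 mulr0.
Qed.

(** The first half contains the cell values of v as a factor, and the second
    half is a sum of cell and face integrals with a factor v. *)
Lemma form_d_null m k u v : cell_deg m u -> vnull v -> form_d m k u v = 0.
Proof.
move=> du v0; apply: etrans (congr2 (fun a b => 2^-1 * a - 2^-1 * b)
  (l2_null (tensor_div m u k) v0) (tensor_divE v k du)) _; rewrite mulr0 sub0r.
rewrite big1 ?mulr0 ?oppr0 // => K Kc; rewrite big1 // => i _.
rewrite /conv_cell big1 ?addr0 => [|e Ke]; last first.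
  apply: (posint_sqr_eq0 (posint_int_face e) (admissible_pev _) (admissible_conv_bd _ _ _ _ _)).
  exact: v0.2 Kc Ke.
rewrite (_ : (fun x => _) = fun=> 0) ?(posint0 (posint_int_cell (ndM Kc))) ?oppr0 //.
by apply/funext => x; rewrite v0.1 // mxE pev0 mul0r.
Qed.

End ConvectionReaction.

(** * Coordinates on the discrete spaces *)

Section Coordinates.
Context {R : realType} {n : nat} (M : mesh R n).
Local Notation simplex := {set 'I_(nnodes M)}.
Local Notation velocity := (@velocity R n M).
Local Notation pressure := (@pressure R n M).
Implicit Types (u v w k : velocity) (p q : pressure).
Hypothesis ndM : forall K, K \in cells M -> nondeg K.
Variables (Omega : set 'rV[R]_n) (m : nat).

Definition vindex := ((simplex * bool) * ('I_n * 'I_(ncoef n m)))%type.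
Definition vdim := #|{: vindex}|.

(** The coefficients indexed by (S, false) and (S, true) are those of the cell
    polynomial and of the face polynomial attached to the simplex S. *)
Definition vel (x : 'rV[R]_vdim) : velocity := Velocity
  (fun K => \row_i poly_of (fun j => x 0 (enum_rank ((K, false), (i, j)))))
  (fun e => \row_i poly_of (fun j => x 0 (enum_rank ((e, true), (i, j))))).

Definition pindex := ((simplex * bool) * 'I_(ncoef n m))%type.
Definition pdim := #|{: pindex}|.

Definition press (z : 'rV[R]_pdim) : pressure := Pressure
  (fun K => poly_of (fun j => z 0 (enum_rank ((K, false), j))))
  (fun e => poly_of (fun j => z 0 (enum_rank ((e, true), j)))).

Lemma vel_lin c x y : vel (c *: x + y) = vlin c (vel x) (vel y).
Proof.
by congr Velocity; apply/funext => S; apply/rowP => i; rewrite !mxE -poly_of_lin;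
  congr poly_of; apply/funext => j; rewrite !mxE.
Qed.

Lemma press_lin c x y : press (c *: x + y) = plin c (press x) (press y).
Proof.
by congr Pressure; apply/funext => S; rewrite /= -poly_of_lin;
  congr poly_of; apply/funext => j; rewrite !mxE.
Qed.

Lemma vel_deg x : cell_deg m (vel x).
Proof. by move=> K _ i; rewrite mxE; exact: poly_of_deg. Qed.

Lemma scalar_vel (h : velocity -> R) : vscalar h -> scalar (h \o vel).
Proof. by move=> hl c x y /=; rewrite vel_lin hl. Qed.

(** The values off the mesh are arbitrary: an element of V_h^0 is of the form
    vel y only up to this relation, which all forms respect. *)
Definition vagree u v := (forall K, K \in cells M -> vin u K = vin v K) /\
  (forall e, mesh_face e -> vbd u e = vbd v e).

Definition pagree p q := (forall K, K \in cells M -> pin p K = pin q K) /\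
  (forall e, mesh_face e -> pbd p e = pbd q e).

Lemma vel_onto v : in_V0 Omega m v -> exists x, vagree (vel x) v.
Proof.
move=> [vi vb _].
exists (\row_a let: ((s, b), (i, j)) := enum_val a in
  mcoeff (bmnm (enum_val j)) ((if b then vbd v s else vin v s) 0 i)).
split=> S HS; apply/rowP => i; rewrite mxE.
  rewrite -[RHS](poly_of_coef (vi S HS i)); congr poly_of.
  by apply/funext => j; rewrite mxE enum_rankK.
rewrite -[RHS](poly_of_coef (vb S HS i)); congr poly_of.
by apply/funext => j; rewrite mxE enum_rankK.
Qed.

Lemma deg_leW a b (s : mpoly n R) : (a <= b)%N -> deg_le a s -> deg_le b s.
Proof. by move=> ab sa; apply: leq_trans sa _; rewrite ltnS. Qed.

Lemma press_onto q : in_Q0 m q -> exists z, pagree (press z) q.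
Proof.
move=> [qi qb _].
exists (\row_a let: ((s, b), j) := enum_val a in
  mcoeff (bmnm (enum_val j)) (if b then pbd q s else pin q s)).
split=> S HS.
  rewrite -[RHS](poly_of_coef (deg_leW (leq_pred m) (qi S HS))); congr poly_of.
  by apply/funext => j; rewrite mxE enum_rankK.
rewrite -[RHS](poly_of_coef (qb S HS)); congr poly_of.
by apply/funext => j; rewrite mxE enum_rankK.
Qed.

Lemma facet_mesh_face K e : K \in cells M -> facet K e -> mesh_face e.
Proof. by move=> Kc Ke; apply/existsP; exists K; rewrite Kc. Qed.

Lemma in_V0_agree u v : vagree u v -> in_V0 Omega m v -> in_V0 Omega m u.
Proof.
move=> [ui ub] [vi vb v0]; split.
- by move=> K Kc; rewrite ui //; exact: vi.
- by move=> e he; rewrite ub //; exact: vb.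
- by move=> e he eO x ex; rewrite ub //; exact: v0.
Qed.

Lemma in_Q0_agree p q : pagree p q -> in_Q0 m q -> in_Q0 m p.
Proof.
move=> [pi pb] [qi qb q0]; split.
- by move=> K Kc; rewrite pi //; exact: qi.
- by move=> e he; rewrite pb //; exact: qb.
- by rewrite -[RHS]q0; apply: eq_bigr => K Kc; rewrite pi.
Qed.

Lemma in_V0_subspace : subspace (in_V0 Omega m \o vel).
Proof.
split=> [|c x y] /=.
  split=> [K _ i|e _ i|e _ _ x _]; rewrite ?mxE; try exact: poly_of_deg.
  apply/rowP => i; rewrite !mxE /poly_of big1 ?pev0 // => j _.
  by rewrite mxE scale0r.
move=> [_ _ x0] [_ _ y0]; split=> [K _ i|e _ i|e he eO z ez].
- by rewrite mxE; exact: poly_of_deg.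
- by rewrite mxE; exact: poly_of_deg.
rewrite vel_lin; apply/rowP => i; rewrite vpevE pev_vbd_lin -!vpevE.
by rewrite (x0 e he eO z ez) (y0 e he eO z ez) !mxE mulr0 addr0.
Qed.

Lemma in_Q0_subspace : subspace (in_Q0 m \o press).
Proof.
split=> [|c x y] /=.
  have P0 S b : poly_of (fun j => (0 : 'rV[R]_pdim) 0 (enum_rank ((S, b), j)))
      = 0 :> mpoly n R.
    by rewrite /poly_of big1 // => j _; rewrite mxE scale0r.
  split=> [K _|e _|]; rewrite /= ?P0; try exact: deg_le0.
  rewrite big1 // => K Kc; rewrite P0 (_ : pev 0 = fun=> 0).
    exact: (posint0 (posint_int_cell (ndM Kc))).
  by apply/funext => z; rewrite pev0.
rewrite press_lin => -[xi xb x0] [yi yb y0]; split=> [K Kc|e he|].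
- by apply: deg_leD; [apply: deg_leZ; exact: xi|exact: yi].
- by apply: deg_leD; [apply: deg_leZ; exact: xb|exact: yb].
apply: etrans _ (etrans (congr2 (fun a b => c * a + b) x0 y0) _); last first.
  by rewrite mulr0 addr0.
rewrite /= mulr_sumr -big_split /=.
apply: eq_bigr => K Kc; rewrite -((posint_int_cell (ndM Kc)).1 c); last 2 first.
- exact: admissible_pev.
- exact: admissible_pev.
by congr (int_cell K _); apply/funext => z; rewrite pevD pevZ.
Qed.

(** The chosen weak gradient depends only on the predicate that defines it. *)
Lemma weak_grad_ext g K (vi : 'rV[R]_n -> R) (vb vb' : simplex -> 'rV[R]_n -> R) :
  (forall e, facet K e -> vb e = vb' e) -> weak_grad g K vi vb = weak_grad g K vi vb'.
Proof.
move=> vbE; congr (xget 0 _); apply/funext => G; apply/propext.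
have sumE (s : 'rV[mpoly n R]_n) :
    \sum_(e | facet K e) int_face e (fun x => vb e x * dotv (vpev s x) (normal K e)) =
    \sum_(e | facet K e) int_face e (fun x => vb' e x * dotv (vpev s x) (normal K e)).
  by apply: eq_bigr => e Ke; rewrite vbE.
by split=> -[dG HG]; split=> // s ds; rewrite HG // sumE.
Qed.

Lemma weak_div_ext g K (vi : 'rV[R]_n -> 'rV[R]_n)
    (vb vb' : simplex -> 'rV[R]_n -> 'rV[R]_n) :
  (forall e, facet K e -> vb e = vb' e) -> weak_div g K vi vb = weak_div g K vi vb'.
Proof.
move=> vbE; congr (xget 0 _); apply/funext => G; apply/propext.
have sumE (s : mpoly n R) :
    \sum_(e | facet K e) int_face e (fun x => dotv (vb e x) (normal K e) * pev s x) =
    \sum_(e | facet K e) int_face e (fun x => dotv (vb' e x) (normal K e) * pev s x).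
  by apply: eq_bigr => e Ke; rewrite vbE.
by split=> -[dG HG]; split=> // s ds; rewrite HG // sumE.
Qed.

Lemma l2_agree (w : simplex -> 'rV[R]_n -> 'rV[R]_n) u v : vagree u v ->
  l2_inner w (fun K => vpev (vin u K)) = l2_inner w (fun K => vpev (vin v K)).
Proof. by move=> [ui _]; apply: eq_bigr => K Kc; rewrite ui. Qed.

Lemma grad_form_agree l u v v' : vagree v v' -> grad_form l u v = grad_form l u v'.
Proof.
move=> [vi vb]; apply: eq_bigr => K Kc; apply: eq_bigr => i _.
have -> // : vgrad l v K i = vgrad l v' K i.
rewrite /vgrad (vi K Kc); apply: weak_grad_ext => e Ke.
by rewrite (vb e (facet_mesh_face Kc Ke)).
Qed.

Lemma jump_form_agree u v v' : vagree v v' -> jump_form u v = jump_form u v'.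
Proof.
move=> [vi vb]; apply: eq_bigr => K Kc; apply: eq_bigr => e Ke.
by rewrite (vi K Kc) (vb e (facet_mesh_face Kc Ke)).
Qed.

Lemma form_a_agree nu l u v v' : vagree v v' -> form_a nu l u v = form_a nu l u v'.
Proof.
move=> va; exact: (congr2 (fun a b => nu * a + nu * b)
  (grad_form_agree l u va) (jump_form_agree u va)).
Qed.

Lemma form_b_agree v v' p p' : vagree v v' -> pagree p p' ->
  form_b m v p = form_b m v' p'.
Proof.
move=> va [pi pb]; apply: etrans (l2_agree _ va) _.
apply: eq_bigr => K Kc.
have -> // : weak_grad m K (pev (pin p K)) (fun e => pev (pbd p e)) =
  weak_grad m K (pev (pin p' K)) (fun e => pev (pbd p' e)).
rewrite (pi K Kc); apply: weak_grad_ext => e Ke.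
by rewrite (pb e (facet_mesh_face Kc Ke)).
Qed.

Lemma form_c_agree al r k u v v' : vagree v v' ->
  form_c al r k u v = form_c al r k u v'.
Proof. move=> va; exact: (congr1 ( *%R al) (l2_agree _ va)). Qed.

Lemma l2_eq (w w' z : simplex -> 'rV[R]_n -> 'rV[R]_n) :
  (forall K, K \in cells M -> w K = w' K) -> l2_inner w z = l2_inner w' z.
Proof. by move=> ww'; apply: eq_bigr => K Kc; rewrite (ww' K Kc). Qed.

Lemma tensor_div_agree k v v' K : vagree v v' -> K \in cells M ->
  tensor_div m v k K = tensor_div m v' k K.
Proof.
move=> [vi vb] Kc; apply/funext => x.
apply: (congr1 (fun h : 'I_n -> mpoly n R => \row_i pev (h i) x)).
apply/funext => i; rewrite (vi K Kc); apply: weak_div_ext => e Ke.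
by rewrite (vb e (facet_mesh_face Kc Ke)).
Qed.

Lemma form_d_agree k u v v' : vagree v v' -> form_d m k u v = form_d m k u v'.
Proof.
move=> va; exact: (congr2 (fun a b => 2^-1 * a - 2^-1 * b)
  (l2_agree (tensor_div m u k) va)
  (l2_eq (fun K => vpev (vin u K)) (fun K Kc => tensor_div_agree k va Kc))).
Qed.

End Coordinates.

(** * Continuity of the nonlinear terms *)

Section Continuity.
Context {R : realType}.

(** The absolute value avoids the jump of powR at 0 from the left. *)
Lemma powR_norm_continuous (s : R) : 0 < s -> continuous (fun a : R => `|a| `^ s).
Proof.
move=> s0 a; have [->|an] := eqVneq a 0; last first.
  apply: (@continuous_comp _ _ _ (fun b : R => `|b|) (@powR R ^~ s)).
    exact: norm_continuous.
  apply/differentiable_continuous/derivable1_diffP; apply: derivable_powR.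
  by rewrite in_itv /= andbT normr_gt0.
apply/cvgrPdist_lt => e e0; rewrite normr0 powR0 ?gt_eqF //.
have /cvgrPdist_lt/(_ e e0) := powR_cvg0 s0.
move=> /nbhs_ballP[d /= d0 Hd]; apply/nbhs_ballP; exists d => //= b.
rewrite /ball /= sub0r normrN => bd; rewrite sub0r normrN.
have [->|bn] := eqVneq b 0; first by rewrite normr0 powR0 ?gt_eqF // normr0.
have := Hd `|b|; rewrite /ball /= !sub0r !normrN normr_id => /(_ bd).
by apply; rewrite normr_gt0.
Qed.

Lemma continuous_mul (T : topologicalType) (f g : T -> R) :
  continuous f -> continuous g -> continuous (fun x => f x * g x).
Proof. by move=> cf cg x; apply: (@continuousM _ _ f g); [exact: cf|exact: cg]. Qed.

Lemma bilinear_continuous N (b : 'rV[R]_N -> 'rV[R]_N -> R) :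
  (forall y, scalar (b ^~ y)) -> (forall x, scalar (b x)) ->
  continuous (fun x => b x x).
Proof.
move=> bl br.
rewrite (_ : (fun x => _) = fun x : 'rV[R]_N =>
    \sum_i (\sum_j (x 0 i * x 0 j) * b (delta_mx 0 i) (delta_mx 0 j))); last first.
  apply/funext => x; rewrite [X in b X _](row_sum_delta x) (scalar_sum _ _ (bl x)).
  apply: eq_bigr => i _.
  rewrite [X in b _ X](row_sum_delta x) (scalar_sum _ _ (br _)) mulr_sumr.
  by apply: eq_bigr => j _; rewrite mulrA.
apply: (@continuous_sum _ R^o) => i; apply: (@continuous_sum _ R^o) => j x.
apply: (@continuousM _ _ (fun x : 'rV[R]_N => x 0 i * x 0 j) (fun=> _));
  last exact: cst_continuous.
apply: (@continuousM _ _ (fun x : 'rV[R]_N => x 0 i) (fun x : 'rV[R]_N => x 0 j));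
  exact: coord_continuous.
Qed.

End Continuity.

Section ReactionContinuity.
Context {R : realType} {n : nat} (M : mesh R n).
Local Notation simplex := {set 'I_(nnodes M)}.
Hypothesis ndM : forall K, K \in cells M -> nondeg K.

Lemma int_cell_le K g eps : K \in cells M -> admissible g ->
  (forall x, geom K x -> `|g x| <= eps) ->
  `|int_cell K g| <= eps * int_cell K (fun=> 1).
Proof.
move=> Kc ng ge; have Jp := posint_int_cell (ndM Kc).
have pos h : (forall x, geom K x -> 0 <= h x) -> 0 <= int_cell K h.
  by move=> h0; apply: Rintegral_ge0 => t; exact: h0.
have E c : int_cell K (fun x => c * g x + eps * 1) = c * int_cell K g +
    eps * int_cell K (fun=> 1).
  rewrite (Jp.1 c) //; last exact: admissible_cst.
  by rewrite (posintZ Jp) //; exact: admissible_cst.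
have h1 : 0 <= int_cell K (fun x => 1 * g x + eps * 1).
  by apply: pos => x /ge; rewrite ler_norml => /andP[]; lra.
have h2 : 0 <= int_cell K (fun x => -1 * g x + eps * 1).
  by apply: pos => x /ge; rewrite ler_norml => /andP[]; lra.
rewrite ler_norml; move: h1 h2; rewrite !E => h1 h2; apply/andP; split; lra.
Qed.

(** Joint continuity of G is uniform in y over a compact cube that contains the
    cell. *)
Lemma int_cell_continuous N K (G : 'rV[R]_n -> 'rV[R]_N -> R) : K \in cells M ->
  (forall x, admissible (G ^~ x)) ->
  continuous (fun yx : 'rV[R]_n * 'rV[R]_N => G yx.1 yx.2) ->
  continuous (fun x => int_cell K (G ^~ x)).
Proof.
move=> Kc nG cG x0; have Jp := posint_int_cell (ndM Kc).
have [B KB] := hull_bounded (node M) K.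
apply/(@cvgrPdist_le R R^o _ (nbhs x0) (nbhs_filter x0)
  (fun x => int_cell K (G ^~ x)) (int_cell K (G ^~ x0))) => e e0.
have V0 : 0 <= int_cell K (fun=> 1) by apply: Jp.2.
(* The 1 keeps the denominator positive. *)
pose d := e / (int_cell K (fun=> 1) + 1).
have d0 : 0 < d by rewrite divr_gt0 // ltr_wpDl.
have /compact_near_coveringP cB : compact (@cube R n B) by exact: cube_compact.
have : \forall x \near x0, @cube R n B `<=` (fun y => `|G y x0 - G y x| < d).
  apply: (cB _ (nbhs x0) (fun x y => `|G y x0 - G y x| < d) (nbhs_filter x0)) => y _.
  have cD : {for (y, x0), continuous (fun yx : 'rV[R]_n * 'rV[R]_N =>
      G yx.1 x0 - G yx.1 yx.2)}.
    apply: (@continuousB _ R^o); last exact: cG.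
    apply: (@continuous_comp _ _ _ (fun yx : 'rV[R]_n * 'rV[R]_N => (yx.1, x0))
      (fun yx => G yx.1 yx.2)); last exact: cG.
    apply: (@cvg_pair _ _ _ (nbhs (y, x0)) (nbhs y) (nbhs x0) (nbhs_filter _)
      (nbhs_filter _) (nbhs_filter _) fst (fun=> x0)); first exact: cvg_fst.
    exact: cvg_cst.
  have := iffLR (@cvgrPdist_lt R R^o _ (nbhs (y, x0)) (nbhs_filter _)
    (fun yx : 'rV[R]_n * 'rV[R]_N => G yx.1 x0 - G yx.1 yx.2) _) cD d d0.
  rewrite /= subrr => H.
  suff : nbhs (y, x0) [set yx : 'rV[R]_n * 'rV[R]_N |
      `|G yx.1 x0 - G yx.1 yx.2| < d] by [].
  by apply: filterS H => yx /=; rewrite sub0r normrN.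
apply: filterS => x Hx.
have nD : admissible (fun y => -1 * G y x + G y x0).
  exact: (admissibleD (admissibleM (admissible_cst _) (nG _)) (nG _)).
rewrite -[X in `|X|](_ : int_cell K (fun y => -1 * G y x + G y x0) = _); last first.
  by rewrite (Jp.1 (-1) _ _ (nG x) (nG x0)) mulN1r addrC.
apply: (le_trans (int_cell_le (eps := d) Kc nD _)).
  by move=> y /KB yB; rewrite mulN1r addrC ltW //; exact: Hx.
rewrite /d mulrAC ler_pdivrMr ?ltr_wpDl // ler_wpM2l ?(ltW e0) //.
by rewrite lerDl.
Qed.

Variables (m : nat) (alpha r : R).
Hypothesis r2 : 0 < r - 2.

Lemma reaction_continuous (v : velocity M) :
  continuous (fun x : 'rV[R]_(@vdim R n M m) =>
    form_c alpha r (vel x) (vel x) v).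
Proof.
move=> x0; apply: continuousM; first exact: cst_continuous.
move: x0; rewrite /l2_inner.
pose F K (x : 'rV[R]_(@vdim R n M m)) := if K \in cells M then int_cell K (fun y =>
   dotv (enorm (vpev (vin (vel x) K) y) `^ (r - 2) *: vpev (vin (vel x) K) y)
        (vpev (vin v K) y)) else 0.
rewrite (_ : (fun x => _) = fun x => \sum_K F K x); last first.
  by apply/funext => x; rewrite [LHS]big_mkcond.
apply: (@continuous_sum _ R^o) => K; rewrite /F.
case Kc: (K \in cells M); last by move=> x; exact: cst_continuous.
apply: (@int_cell_continuous _ K (fun y x =>
  dotv (enorm (vpev (vin (vel x) K) y) `^ (r - 2) *: vpev (vin (vel x) K) y)
        (vpev (vin v K) y))) => // [x|].
  by apply: admissible_dotv => i; [apply: admissible_reaction; exact: ltW|exact: admissible_vpev].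
pose W i (yx : 'rV[R]_n * 'rV[R]_(@vdim R n M m)) := pev (vin (vel yx.2) K 0 i) yx.1.
have cW i : continuous (W i).
  rewrite (_ : W i = fun yx => \sum_j yx.2 0 (enum_rank ((K, false), (i, j))) *
      pev (mpolyX R (bmnm (enum_val j))) yx.1); last first.
    apply/funext => yx; rewrite /W mxE /poly_of pev_sum.
    by apply: eq_bigr => j _; rewrite pevZ.
  apply: (@continuous_sum _ R^o) => j.
  apply: (@continuous_mul _ _ (fun yx : 'rV[R]_n * 'rV[R]_(@vdim R n M m) =>
      yx.2 0 (enum_rank ((K, false), (i, j))))
    (fun yx => pev (mpolyX R (bmnm (enum_val j))) yx.1)) => yx.
    apply: (@continuous_comp _ _ _ snd
      (fun x : 'rV[R]_(@vdim R n M m) => x 0 (enum_rank ((K, false), (i, j))))).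
      exact: cvg_snd.
    exact: coord_continuous.
  apply: (@continuous_comp _ _ _ fst (pev (mpolyX R (bmnm (enum_val j))))).
    exact: cvg_fst.
  exact: pev_continuous.
rewrite (_ : (fun yx => _) = fun yx => `|Num.sqrt (\sum_i W i yx * W i yx)| `^ (r - 2) *
    \sum_i W i yx * pev (vin v K 0 i) yx.1); last first.
  apply/funext => yx; rewrite dotvZl ger0_norm ?sqrtr_ge0 //.
  have -> : \sum_i W i yx * pev (vin v K 0 i) yx.1 =
      dotv (vpev (vin (vel yx.2) K) yx.1) (vpev (vin v K) yx.1).
    by apply: eq_bigr => i _; rewrite !vpevE.
  have -> // : \sum_i W i yx * W i yx =
      dotv (vpev (vin (vel yx.2) K) yx.1) (vpev (vin (vel yx.2) K) yx.1).
  by apply: eq_bigr => i _; rewrite !vpevE.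
apply: (@continuous_mul _ _
    (fun yx => `|Num.sqrt (\sum_i W i yx * W i yx)| `^ (r - 2))
    (fun yx => \sum_i W i yx * pev (vin v K 0 i) yx.1)) => [yx|].
  apply: (@continuous_comp _ _ _ (fun yx => Num.sqrt (\sum_i W i yx * W i yx))
    (fun a => `|a| `^ (r - 2))); last exact: powR_norm_continuous.
  apply: (@continuous_comp _ _ _ (fun yx => \sum_i W i yx * W i yx) Num.sqrt);
    last exact: sqrt_continuous.
  by apply: (@continuous_sum _ R^o) => i; exact: (continuous_mul (cW i) (cW i)).
apply: (@continuous_sum _ R^o) => i.
apply: (@continuous_mul _ _ (W i) (fun yx => pev (vin v K 0 i) yx.1)); first exact: cW.
move=> yx; apply: (@continuous_comp _ _ _ fst (pev (vin v K 0 i))).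
  exact: cvg_fst.
exact: pev_continuous.
Qed.

End ReactionContinuity.

(** * Solvability of one time step *)

Section Step.
Context {R : realType} {n : nat} (M : mesh R n).
Local Notation simplex := {set 'I_(nnodes M)}.
Local Notation RT := (measurableTypeR R).
Local Notation velocity := (@velocity R n M).
Local Notation pressure := (@pressure R n M).
Implicit Types (u v w k : velocity) (p q : pressure).
Hypothesis ndM : forall K, K \in cells M -> nondeg K.
Variable Omega : set 'rV[R]_n.
Hypothesis cellsO : closure Omega = \bigcup_(K in [set` cells M]) geom K.

(** The source is only square integrable, so its products with polynomials are
    integrable without being admissible. *)
Lemma vscalar_load (f : 'rV[R]_n -> 'rV[R]_n) :
  (forall i, L2_on (closure Omega) (fun x => f x 0 i)) ->
  vscalar (fun v => l2_inner (fun=> f) (fun K => vpev (vin v K))).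
Proof.
move=> f2.
have mO : measurable (@vec_of_tuple R n @^-1` closure Omega : set (n.-tuple RT)).
  rewrite cellsO preimage_bigcup; apply: fin_bigcup_measurable => // K /= Kc.
  exact: (measurable_cell_region (ndM Kc)).
apply: vscalar_sum => K Kc.
have mK := measurable_cell_region (ndM Kc).
have KO : geom K `<=` closure Omega by rewrite cellsO => x Kx; exists K.
have int u : (lebesgue_tuple n).-integrable (cell_region K)
    (EFin \o (fun t => dotv (f (vec_of_tuple t)) (vpev (vin u K) (vec_of_tuple t)))).
  rewrite (_ : (fun t => _) = \sum_i (fun t => vpev (vin u K) (vec_of_tuple t) 0 i *
      f (vec_of_tuple t) 0 i)); last first.
    by apply/funext => t; rewrite fct_sumE; apply: eq_bigr => i _; rewrite mulrC.
  apply: (big_ind (fun h : n.-tuple RT -> R =>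
    (lebesgue_tuple n).-integrable (cell_region K) (EFin \o h))) => [|h1 h2 i1 i2|i _].
  - exact: integrable0.
  - exact: (integrableD mK i1 i2).
  - exact: (L2_mul_integrable (ndM Kc) mO KO (f2 i) (admissible_vpev _ i)).
move=> c u v; rewrite /int_cell /int_on.
rewrite -RintegralZl // -RintegralD //; last first.
  by have := integrableZl mK c (int u).
apply: eq_Rintegral => t _; rewrite /dotv mulr_sumr -big_split /=.
by apply: eq_bigr => i _; rewrite !vpevE pev_vin_lin; ring.
Qed.

Lemma l2_difference_quotient (c : R) u w v :
  l2_inner (fun K x => c *: (vpev (vin u K) x - vpev (vin w K) x))
    (fun K => vpev (vin v K)) =
  c * l2_inner (fun K => vpev (vin u K)) (fun K => vpev (vin v K)) -
  c * l2_inner (fun K => vpev (vin w K)) (fun K => vpev (vin v K)).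
Proof.
rewrite -mulrBr /l2_inner -sumrB mulr_sumr; apply: eq_bigr => K Kc.
have Jp := posint_int_cell (ndM Kc).
have nd z : admissible (fun x => dotv (vpev (vin z K) x) (vpev (vin v K) x)).
  by apply: admissible_dotv => i; exact: admissible_vpev.
rewrite -[in RHS]mulN1r [X in c * X]addrC -(Jp.1 (-1) _ _ (nd w) (nd u)).
rewrite -(posintZ Jp) //; last exact: (admissibleD (admissibleM (admissible_cst _) (nd w)) (nd u)).
congr (int_cell K _); apply/funext => x; rewrite dotvZl; congr (_ * _).
rewrite /dotv mulr_sumr -big_split /=; apply: eq_bigr => i _.
by rewrite vpevB !vpevE; ring.
Qed.

(** The velocity comes from galerkin, with the reaction and convection terms as
    T, and the pressure from multiplier applied to the residual. *)
Lemma step_exists (m l : nat) (nu alpha r dt : R) (f : 'rV[R]_n -> 'rV[R]_n)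
    (uprev : velocity) :
  (0 < n)%N -> 0 < nu -> 0 < alpha -> 2 < r -> 0 < dt ->
  (forall i, L2_on (closure Omega) (fun x => f x 0 i)) ->
  exists u p, solves_step Omega m l nu alpha r dt f uprev u p.
Proof.
move=> n0 nu0 al0 r2 dt0 f2.
have r20 : 0 < r - 2 by rewrite subr_gt0.
pose E := 'rV[R]_(@vdim R n M m).
pose ip u v := l2_inner (fun K => vpev (vin u K)) (fun K => vpev (vin v K)).
pose s (x y : E) := dt^-1 * ip (vel x) (vel y) + form_a nu l (vel x) (vel y).
pose T (x v : E) := form_c alpha r (vel x) (vel x) (vel v) +
  form_d m (vel x) (vel x) (vel v).
pose g (v : E) := dt^-1 * ip uprev (vel v) +
  l2_inner (fun=> f) (fun K => vpev (vin (vel v) K)).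
pose P (x : E) := in_V0 Omega m (vel x) /\
  forall z : 'rV[R]_(@pdim R n M m), in_Q0 m (press z) ->
    form_b m (vel x) (press z) = 0.
have dtV0 : 0 < dt^-1 by rewrite invr_gt0.
have ip_lin u : vscalar (ip u).
  by apply: (vscalar_l2 ndM) => K i _; exact: admissible_vpev.
have sl y : scalar (s ^~ y).
  apply: (@scalar_vel _ _ _ _ (fun u => dt^-1 * ip u (vel y) + form_a nu l u (vel y))).
  apply: vscalarD; last exact: (vscalar_form_a ndM).
  by apply: vscalarZ => c u v; rewrite /ip !(l2C _ (fun K => vpev (vin (vel y) K)));
    exact: ip_lin.
have form_a_ge0 u : 0 <= form_a nu l u u.
  rewrite form_aE addr_ge0 ?mulr_ge0 ?(ltW nu0) ?(grad_form_ge0 ndM) //.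
  exact: (jump_form_ge0 ndM n0).
have sP : psd_form s.
  split=> [x y|y|x]; [|exact: sl|].
    exact: (congr2 (fun a b => dt^-1 * a + b) (l2C _ _) (form_aC nu l _ _)).
  by rewrite addr_ge0 ?mulr_ge0 ?(ltW dtV0) ?(l2_ge0 ndM).
have V0P := in_V0_subspace M Omega m.
have Q0P := in_Q0_subspace ndM m.
have bl q : vscalar (fun v => form_b m v q) by exact: (vscalar_form_b ndM).
have PP : subspace P.
  split => [|c x y [x0 xb] [y0 yb]].
    split; first exact: V0P.1.
    by move=> z _; exact: (scalar0 (scalar_vel (bl (press z)))).
  split; first exact: V0P.2.
  by move=> z zq; rewrite vel_lin bl xb // yb // mulr0 addr0.
have gl : scalar g.
  apply: (@scalar_vel _ _ _ _ (fun v => dt^-1 * ip uprev v +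
    l2_inner (fun=> f) (fun K => vpev (vin v K)))).
  by apply: vscalarD; [apply: vscalarZ; exact: ip_lin|exact: vscalar_load].
have Tl x : scalar (T x).
  apply: (@scalar_vel _ _ _ _ (fun v => form_c alpha r (vel x) (vel x) v +
    form_d m (vel x) (vel x) v)).
  apply: vscalarD; first exact: (vscalar_form_c ndM alpha (ltW r20)).
  exact: (vscalar_form_d ndM _ (vel_deg x)).
have Tc (v : E) : continuous (T ^~ v).
  move=> x; apply: (@continuousD _ R^o _
    (fun x : E => form_c alpha r (vel x) (vel x) (vel v))
    (fun x : E => form_d m (vel x) (vel x) (vel v))).
    exact: (@reaction_continuous R n M ndM m alpha r r20 (vel v) x).
  apply: (@bilinear_continuous _ _ (fun x y : E => form_d m (vel x) (vel y) (vel v))).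
    move=> y; apply: (@scalar_vel _ _ _ _ (fun k => form_d m k (vel y) (vel v))).
    exact: (vscalar_form_d_adv ndM (vel_deg y) (vel_deg v)).
  move=> y; apply: (@scalar_vel _ _ _ _ (fun u => form_d m (vel y) u (vel v))).
  exact: (vscalar_form_d_tr ndM _ (vel_deg v)).
have T0 x : P x -> 0 <= T x x.
  by move=> _; rewrite /T form_d_diag addr0 (form_c_ge0 ndM) // ltW.
have null (v : E) : s v v = 0 -> g v = 0 /\ forall x, T x v = 0.
  move=> /eqP; rewrite paddr_eq0 ?mulr_ge0 ?(ltW dtV0) ?(l2_ge0 ndM) //.
  rewrite mulf_eq0 gt_eqF //= => /andP[/eqP ip0 /eqP a0].
  have v0 := vnull_energy ndM n0 nu0 ip0 a0.
  split=> [|x].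
    apply: etrans (congr2 (fun a b => dt^-1 * a + b) (l2_null ndM _ v0)
      (l2_null ndM _ v0)) _.
    by rewrite mulr0 addr0.
  apply: etrans (congr2 (fun a b => alpha * a + b) (l2_null ndM _ v0)
    (form_d_null ndM _ (vel_deg x) v0)) _.
  by rewrite mulr0 addr0.
have [x [x0 xb] xE] := galerkin sP PP gl Tl Tc T0 null.
have hl : scalar (fun v : E => g v - (s x v + T x v)).
  have sr y : scalar (s y) by case: sP => sC _ _ c a b; rewrite !(sC y) sl.
  move=> c a b; rewrite (gl c a b) (Tl x c a b) (sr x c a b).
  by move: (g a) (g b) (s x a) (s x b) (T x a) (T x b) => *; ring.
have br (v : E) : in_V0 Omega m (vel v) -> forall c (q q' : 'rV[R]_(@pdim R n M m)),
    form_b m (vel v) (press (c *: q + q')) =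
    c * form_b m (vel v) (press q) + form_b m (vel v) (press q').
  by move=> _ c q q'; rewrite press_lin; exact: (form_b_linr ndM (vel_deg v)).
have h0 (v : E) : in_V0 Omega m (vel v) ->
    (forall z : 'rV[R]_(@pdim R n M m), in_Q0 m (press z) -> form_b m (vel v) (press z) = 0) ->
    g v - (s x v + T x v) = 0.
  by move=> v0 vb; apply/eqP; rewrite subr_eq0 eq_sym; apply/eqP/xE.
have [z zQ zE] := multiplier V0P Q0P
  (fun z => scalar_vel (bl (press z))) br hl h0.
exists (vel x), (press z); split=> // v q /[dup] v0 /vel_onto[y yv] /[dup] q0 /press_onto[c cq].
have y0 : in_V0 Omega m (vel y) := in_V0_agree yv v0.
have c0 : in_Q0 m (press c) := in_Q0_agree cq q0.
split; last first.
  have xx : vagree (vel x) (vel x) by split.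
  exact: etrans (esym (form_b_agree m xx cq)) (xb c c0).
have e1 := etrans (l2_difference_quotient dt^-1 (vel x) uprev v)
  (congr2 (fun a b => dt^-1 * a - dt^-1 * b)
    (esym (l2_agree _ yv)) (esym (l2_agree _ yv))).
have ea := esym (form_a_agree nu l (vel x) yv).
have eb : form_b m v (press z) = form_b m (vel y) (press z).
  have zz : pagree (press z) (press z) by split.
  exact: esym (form_b_agree m yv zz).
have ec := esym (form_c_agree alpha r (vel x) (vel x) yv).
have ed := esym (form_d_agree m (vel x) (vel x) yv).
have ef := l2_agree (fun=> f) yv.
apply: etrans (congr2 +%R (congr2 +%R (congr2 +%R (congr2 +%R e1 ea) eb) ec) ed) _.
apply: etrans _ ef; have := zE y y0; rewrite /g /s /T /ip.
move: (l2_inner (fun K => vpev (vin (vel x) K)) _) (l2_inner (fun K => vpev (vin uprev K)) _).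
move: (form_a _ _ _ _) (form_b _ _ _) (form_c _ _ _ _ _) (form_d _ _ _ _) (l2_inner _ _).
by move=> A B C D F U W <-; ring.
Qed.

End Step.

Theorem theorem5p2 (R : realType) (n : nat) (hn : n = 2%N \/ n = 3%N)
  (Omega : set 'rV[R]_n) (hOmega : polyhedral_domain Omega)
  (T nu alpha r : R) (hT : 0 < T) (hnu : 0 < nu) (halpha : 0 < alpha)
  (hr : 3 <= r) (hr3 : n = 3%N -> r <= 6)
  (f : 'rV[R]_n -> R -> 'rV[R]_n) (u0 : 'rV[R]_n -> 'rV[R]_n)
  (Th : mesh R n) (sigma : R)
  (hTh : is_partition Th Omega) (hreg : shape_regular Th sigma)
  (m l N : nat) (hm : (1 <= m)%N) (hl : l = m.-1 \/ l = m) (hN : (0 < N)%N)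
  (hf : forall (k : nat) (i : 'I_n), (1 <= k <= N)%N ->
     L2_on (closure Omega) (fun x => f x (k%:R * (T / N%:R)) 0 i))
  (hu0 : initial_datum Th Omega u0) :
  forall k : nat, (1 <= k <= N)%N ->
  forall (u : nat -> velocity Th) (p : nat -> pressure Th),
    initial_value m u0 (u 0%N) ->
    (forall j : nat, (1 <= j < k)%N ->
       solves_step Omega m l nu alpha r (T / N%:R)
         (fun x => f x (j%:R * (T / N%:R))) (u j.-1) (u j) (p j)) ->
  exists (uk : velocity Th) (pk : pressure Th),
    solves_step Omega m l nu alpha r (T / N%:R)
      (fun x => f x (k%:R * (T / N%:R))) (u k.-1) uk pk.
Proof.
move=> k hk u p _ _; have [ndM _ cellsO _] := hTh.
apply: (step_exists ndM cellsO) => //.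
- by case: hn => ->.
- by apply: lt_le_trans hr; rewrite ltr_nat.
- by rewrite divr_gt0 // ltr0n.
- by move=> i; exact: hf.
Qed.
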